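(* Fix an integer $g\ge 2$. For every $k\ge2$ consider the differential operator on $\mathbb Q[x_1,x_2,\ldots]$ $$D_k=\frac1{k!}\sum_{n_1,\ldots,n_k\ge1}\frac{(n_1+\ldots+n_k)!}{n_1!\cdots n_k!}\,x_{n_1+\ldots+n_k-1}\,\partial_{n_1}\cdots\partial_{n_k},$$ and let $D=D_2-g\,\partial_1$. Then for every $k\ge3$ one has $[D_k,D]=0$, and $D_k$ descends to an operator on $R^{\mathrm{Jac}}_g$. Furthermore, for every $k\ge2$ one has $$S(p_k\cdot S^{-1}F)=D_{k+1}(F)$$ for all $F\in R^{\mathrm{Jac}}_g$, where the ring $R_g^{\mathrm{Jac}}$, the classes $p_k$ and the operator $S$ are defined in the context.
   Context: $\partial_i=\partial/\partial x_i$; $\mathbb Q[x_1,x_2,\ldots]$ is graded by $\deg x_i=i$. Let $I_g\subset\mathbb Q[x_1,x_2,\ldots]$ be the linear span of all homogeneous polynomials of degree $>g$ and of all polynomials $D^d(x_1^{m_1}\cdots x_k^{m_k})$ with $d\ge0$, $m_1+2m_2+\ldots+km_k=g$, $m_1<g$. It is an ideal; $R^{\mathrm{Jac}}_g=\mathbb Q[x_1,x_2,\ldots]/I_g$, and $p_i$ is the image of $x_i$ in $R^{\mathrm{Jac}}_g$. $S$ is the linear operator on $R^{\mathrm{Jac}}_g$ (well defined and invertible) given, for $k\ge0$, $n\ge0$ and $n_i>1$, by $$(-1)^nS(p_1^{[n]}p_{n_1}\cdots p_{n_k})=\sum_{[1,k]=I_1\sqcup\ldots\sqcup I_m}b(I_1)\cdots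 b(I_m)\,p_1^{[g-n-m-\sum_{i=1}^k n_i]}\,p_{d(I_1)}\cdots p_{d(I_m)},$$ where the sum is over all unordered partitions of $[1,k]=\{1,\ldots,k\}$ into nonempty subsets (for $k=0$ only the empty partition, $m=0$), $p_1^{[d]}=p_1^d/d!$ for $d\ge0$, $p_1^{[d]}=0$ for $d<0$, and for $I=\{i_1,\ldots,i_s\}$: $b(I)=\frac{(n_{i_1}+\ldots+n_{i_s})!}{n_{i_1}!\cdots n_{i_s}!}$, $d(I)=n_{i_1}+\ldots+n_{i_s}-s+1$. *)

(* Defs.v *)
From HB Require Import structures.
From mathcomp Require Import all_boot all_order all_algebra.
From mathcomp Require Import finmap monalg.
Set Implicit Arguments.
Unset Strict Implicit.
Unset Printing Implicit Defensive.
Import GRing.Theory.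
Local Open Scope ring_scope.

(* Q[x_1, x_2, ...]: the variable x_n, n >= 1, is the one with index n.-1 in   *)
(* the free commutative monoid on nat (the indexing convention of mnmwgt), so  *)
(* the exponent of x_n in a monomial m is m n.-1.  The index n = 0 is never    *)
(* used below.                                                                 *)
Notation QX := {malg rat[{cmonom nat}]}.

Definition xvar (n : nat) : QX := << ucm n.-1 >>.

Definition pd (n : nat) (f : QX) : QX :=
  \sum_(m <- msupp f)
     (f@_m * (m n.-1)%:R) *: (<< divcm m (ucm n.-1) >> : QX).

(* The grading deg x_n = n. *)
Definition wdeg (m : {cmonom nat}) : nat :=
  (\sum_(i <- finsupp m) m i * i.+1)%N.

Definition whomog (d : nat) (f : QX) : Prop :=
  forall m, m \in msupp f -> wdeg m = d.

(* (n_1 + ... + n_k)! / (n_1! ... n_k!) *)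
Definition multinom (s : seq nat) : rat :=
  (sumn s)`!%:R / \prod_(j <- s) j`!%:R.

Definition Dterm (s : seq nat) (f : QX) : QX :=
  multinom s *: (xvar (sumn s).-1 * foldr pd f s).

Definition Dop_upto (N k : nat) (f : QX) : QX :=
  (k`!%:R)^-1 *:
    \sum_(t : k.-tuple 'I_N) Dterm [seq (nat_of_ord i).+1 | i <- t] f.

(* x_n does not occur in f for n > nvars f. *)
Definition nvars (f : QX) : nat :=
  (\max_(m <- msupp f) \max_(i <- finsupp m) i.+1)%N.

(* The sum over all n_1, ..., n_k >= 1 is cut off at n_i <= nvars f; by        *)
(* Dop_uptoE the omitted terms vanish on f.                                    *)
Definition Dop (k : nat) (f : QX) : QX := Dop_upto (nvars f) k f.

Definition Dg (g : nat) (f : QX) : QX := Dop 2 f - g%:R *: pd 1 f.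

Definition lin_span (A : QX -> Prop) (f : QX) : Prop :=
  exists s : seq (rat * QX),
    (forall cp, cp \in s -> A cp.2) /\ f = \sum_(cp <- s) cp.1 *: cp.2.

Definition jac_gen (g : nat) (f : QX) : Prop :=
  (exists2 d, (g < d)%N & whomog d f) \/
  (exists (d : nat) (m : {cmonom nat}),
     [/\ wdeg m = g, (m 0 < g)%N & f = iter d (Dg g) << m >>]).

(* The ideal I_g. *)
Definition jacI (g : nat) : QX -> Prop := lin_span (jac_gen g).

(* pi : Q[x_1, x_2, ...] -> R presents R as the quotient ring Q[x]/I_g; this   *)
(* determines (R, pi) up to a unique isomorphism.                              *)
Definition is_RJac (g : nat) (R : comAlgType rat) (pi : {lrmorphism QX -> R}) :
    Prop :=
  (forall F : R, exists f : QX, pi f = F) /\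
  (forall f : QX, pi f = 0 <-> jacI g f).

Definition divpow (R : comAlgType rat) (p : R) (z : int) : R :=
  if z is Posz d then (d`!%:R : rat)^-1 *: p ^+ d else 0.

Definition bcoef (k : nat) (ns : 'I_k -> nat) (I : {set 'I_k}) : rat :=
  multinom [seq ns i | i in I].

Definition dindex (k : nat) (ns : 'I_k -> nat) (I : {set 'I_k}) : nat :=
  ((\sum_(i in I) ns i).+1 - #|I|)%N.

(* The partitions Q of [set: 'I_k] are the unordered partitions of [1, k] into *)
(* nonempty subsets, and m = #|Q|.                                             *)
Definition Sformula (R : comAlgType rat) (p : nat -> R) (g k : nat)
    (ns : 'I_k -> nat) (n : nat) : R :=
  \sum_(Q : {set {set 'I_k}} | partition Q [set: 'I_k])
    (\prod_(I in Q) bcoef ns I) *: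
      (divpow (p 1%N)
         (g%:Z - n%:Z - #|Q|%:Z - (\sum_(i < k) ns i)%N%:Z)
       * \prod_(I in Q) p (dindex ns I)).

(* The formula determines S: the classes p_1^[n] p_{n_1} ... p_{n_k} span R.   *)
Definition is_S (g : nat) (R : comAlgType rat) (pi : {lrmorphism QX -> R})
    (S : {linear R -> R}) : Prop :=
  let p n := pi (xvar n) in
  forall (k n : nat) (ns : 'I_k -> nat), (forall i, (1 < ns i)%N) ->
    (-1) ^+ n * S (divpow (p 1%N) n%:Z * \prod_(i < k) p (ns i))
    = Sformula p g ns n.

Definition free_of (n : nat) (f : QX) : Prop :=
  forall m, m \in msupp f -> m n.-1 = 0%N.

Lemma pd_free n f : free_of n f -> pd n f = 0.
Proof.
move=> hf; rewrite /pd big_seq big1 // => m hm.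
by rewrite hf // mulr0 scale0r.
Qed.

Lemma mcoeff_pd n f m : (pd n f)@_m = f@_(mmul m (ucm n.-1)) * (m n.-1).+1%:R.
Proof.
rewrite /pd raddf_sum /=.
transitivity (\sum_(m' <- msupp f | m' == mmul m (ucm n.-1))
                f@_m' * (m' n.-1)%:R).
  rewrite [RHS]big_mkcond /=; apply: eq_bigr => m' _.
  rewrite mcoeffZ mcoeffU; case: ifP => [/eqP ->|neq].
    rewrite (_ : divcm _ _ = m) ?eqxx ?mulr1 //.
    by apply/eqP/cmP => i; rewrite divcmE cmM addnK.
  case: eqP => [eqm|_]; last by rewrite mulr0.
  case: (posnP (m' n.-1)) => [->|m'_gt0]; first by rewrite mulr0 mul0r.
  case/negP: neq; apply/cmP => i; rewrite -eqm cmM divcmE cmU.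
  by case: eqP => [<-|]; rewrite ?subnK ?subn0 ?addn0.
case: (boolP (mmul m (ucm n.-1) \in msupp f)) => [hm|hm]; last first.
  rewrite (mcoeff_outdom hm) mul0r big_seq_cond big1 // => m' /andP[hm' /eqP em].
  by rewrite em (negbTE hm) in hm'.
rewrite -big_filter filter_pred1_uniq ?fset_uniq // big_seq1.
by rewrite cmM cmUU addn1.
Qed.

Lemma free_of_pd n j f : free_of n f -> free_of n (pd j f).
Proof.
move=> hf m; rewrite -mcoeff_neq0 mcoeff_pd mulf_eq0 negb_or => /andP[+ _].
rewrite mcoeff_neq0 => /hf; rewrite cmM => /eqP.
by rewrite addn_eq0 => /andP[/eqP].
Qed.

Lemma pd0 n : pd n 0 = 0.
Proof. by rewrite /pd msupp0 big_nil. Qed.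

Lemma Dterm_free n s f : n \in s -> free_of n f -> Dterm s f = 0.
Proof.
move=> ns hf; rewrite /Dterm.
suff -> : foldr pd f s = 0 by rewrite mulr0 scaler0.
elim: s ns => //= j s IHs; rewrite inE; case: eqP => [<- _|_ /= /IHs ->].
  by apply: pd_free; elim: s {IHs} => //= i s; apply: free_of_pd.
exact: pd0.
Qed.

Lemma free_of_nvars n f : (nvars f < n)%N -> free_of n f.
Proof.
move=> hn m hm; apply/eqP; rewrite cmE_eq0; apply/negP => hi.
suff : (n <= nvars f)%N by rewrite leqNgt hn.
have le_n : (n <= \max_(i <- finsupp m) i.+1)%N.
  apply: leq_trans (leqSpred n) _.
  exact: (@leq_bigmax_seq _ _ predT (fun i => i.+1) _ hi isT).
apply: leq_trans le_n _; exact: (@leq_bigmax_seq _ _ predT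
  (fun m : {cmonom nat} => \max_(i <- finsupp m) i.+1)%N _ hm isT).
Qed.

Lemma Dop_uptoE N k f : (nvars f <= N)%N -> Dop_upto N k f = Dop k f.
Proof.
move=> hN; rewrite /Dop /Dop_upto; congr (_ *: _).
pose w := widen_ord hN; pose h (t : k.-tuple 'I_(nvars f)) := map_tuple w t.
have w_inj : injective w by move=> i j /(congr1 val) => e; apply/val_inj.
have h_inj : injective h.
  move=> t u /(congr1 val) e; apply/val_inj; exact: (inj_map w_inj e).
rewrite (bigID [in h @: [set: k.-tuple 'I_(nvars f)]]) /=.
rewrite [X in _ + X]big1 ?addr0 => [|t tN]; last first.
  have /allPn[i it] : ~~ all (fun i : 'I_N => i < nvars f)%N t.
    apply: contra tN => /allP ht.
    case: (posnP k) => [k0|k_gt0].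
      subst k; rewrite (tuple0 t); apply/imsetP.
      by exists [tuple]; [rewrite in_setT | exact/esym/tuple0].
    have n_gt0 : (0 < nvars f)%N.
      by apply: leq_ltn_trans (ht _ (mem_tnth (Ordinal k_gt0) t)).
    pose u := map_tuple (fun i : 'I_N => insubd (Ordinal n_gt0) (val i)) t.
    apply/imsetP; exists u; [by rewrite in_setT | apply/val_inj => /=].
    rewrite -map_comp -[LHS]map_id; apply/eq_in_map => i it.
    by apply/val_inj; rewrite /= val_insubd ht.
  rewrite -leqNgt => hi.
  apply: (@Dterm_free i.+1); last exact: free_of_nvars.
  by apply/mapP; exists i.
rewrite big_imset /=; last by move=> t u _ _; apply: h_inj.
apply: eq_big => [t|t _]; first by rewrite inE.
by rewrite -map_comp; congr Dterm; apply: eq_map.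
Qed.

(* Main.v *)
(* With p_n = d/dx_n and p(t) = sum_n p_n t^n / n!, the operator D_k becomes the   *)
(* vector field p(t) |-> d/dt (p(t)^k / k!), one of the commuting flows of the      *)
(* Hopf hierarchy; the extra term of D only involves p_1, which is fixed by the     *)
(* flows with k >= 3.                                                               *)
(*                                                                                  *)
(* That D_k preserves I_g reduces, by commutation with D, to showing that D_k maps  *)
(* a monomial x_1^[a] M of degree g, with M <> 1 free of x_1, into the image of D.  *)
(* Modulo this image every monomial of degree g-1 is a multiple of a power of x_1   *)
(* times a single variable, and for a >= k the scalars sum up to an alternating     *)
(* sum over the factors of M that vanishes. Small a is reduced to large a by        *)
(* passing from g to g+k and applying (d/dx_1)^k.                                   *)
(*                                                                                  *)
(* The formula for S makes sense in Q[x], where S(x_k f) = D_(k+1) S(f) holds       *)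
(* exactly: D_(k+1) merges some blocks of a set partition with the new index, and   *)
(* comparing coefficients leaves an identity of Abel-Rothe-Hurwitz type for sums    *)
(* over set partitions.                                                             *)

(* All operators here lie in one family: [opX n k] is attached to the Hamiltonian t^n p^k / (n! k!),
   with D_k = [opX 0 k] and multiplication by x_(n-1) = [opX n 0]. Commuting with a variable stays
   inside the family ([opX_var]), so identities are checked on 1 and propagated by multiplying with
   one variable at a time. Commutators follow the Poisson bracket ([opX_bracket]), and Hamiltonians
   in p alone commute; together with [der1_opX] this gives [D_k, D] = 0.

   For the descent, a polynomial of degree > g is sent to degree >= g, and in degree g the power
   x_1^g does not occur ([opX_mon_spanned]). For a generator D^d(m), commutation leaves D_k(m),
   which must be D of a combination of admissible monomials of degree g ([opX_lowmon]). Its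
   expansion [opX_prod] is brought to the normal form [reduces_all] modulo such images, where the
   coefficients cancel in pairs by [falling_step].

   For S, [opX_Sform] shows that D_(k+1) applied to the lifted formula inserts an index of value k:
   the blocks hit by derivatives merge with the new index. The ways of cutting a merged block into
   old blocks are summed by [sum_partition_bcoef], which rests on [sum_partition_rothe] and the
   convolution identity [rothe_convolution]. *)
Require Import Defs.
From HB Require Import structures.
From mathcomp Require Import all_boot all_order all_algebra.
From mathcomp Require Import finmap monalg.
From mathcomp Require Import ring lra zify.
Set Implicit Arguments.
Unset Strict Implicit.
Unset Printing Implicit Defensive.
Import GRing.Theory Num.Theory.
Local Open Scope ring_scope.

(** * Operators on polynomials in infinitely many variables *)

(* Q[x_1, x_2, ...] with its partial derivatives, kept abstract because        *)
(* unification on monoid algebras unfolds their implementation.                *)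
Record derivAlg := DerivAlg {
  derivAlg_sort :> comAlgType rat;
  var : nat -> derivAlg_sort;
  der : nat -> {linear derivAlg_sort -> derivAlg_sort};
  vbound : derivAlg_sort -> nat;
  der_one : forall n, der n 1 = 0;
  der_var : forall n j f, (0 < n)%N -> (0 < j)%N ->
    der n (var j * f) = var j * der n f + (n == j)%:R *: f;
  der_vbound : forall n f, (vbound f < n)%N -> der n f = 0;
  derivAlg_ind : forall P : derivAlg_sort -> Prop,
    P 1 -> (forall c f h, P f -> P h -> P (c *: f + h)) ->
    (forall j f, (0 < j)%N -> P f -> P (var j * f)) -> forall f, P f
}.

Section Operators.
Context {A : derivAlg}.
Implicit Types (f h : A) (n k N j : nat).

Lemma derC i j f : (0 < i)%N -> (0 < j)%N -> der A i (der A j f) = der A j (der A i f).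
Proof.
move=> i0 j0; elim/derivAlg_ind: f => [|c f h ef eh|l f l0 ef].
- by rewrite !der_one !linear0.
- by rewrite !linearP /= ef eh.
rewrite !der_var // !linearD !linearZ /= !der_var // ef.
by rewrite -!addrA; congr (_ + _); rewrite addrC.
Qed.

(* [opX n k] is the sum of (n + n_1 + ... + n_k)! / (n! k! n_1! ... n_k!)       *)
(* x_(n + n_1 + ... + n_k - 1) d_(n_1) ... d_(n_k); it contains both D_k, for   *)
(* n = 0, and multiplication by x_(n-1), for k = 0.                             *)
Fixpoint opX_upto N n k f : A :=
  if k is k'.+1 then
    k%:R^-1 *: \sum_(i < N) 'C(n + i.+1, n)%:R *: opX_upto N (n + i.+1) k' (der A i.+1 f)
  else var A n.-1 * f.

Arguments opX_upto : simpl never.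

Lemma opX_upto0 N n f : opX_upto N n 0 f = var A n.-1 * f. Proof. by []. Qed.

Lemma opX_uptoS N n k f : opX_upto N n k.+1 f =
  k.+1%:R^-1 *: \sum_(i < N) 'C(n + i.+1, n)%:R *: opX_upto N (n + i.+1) k (der A i.+1 f).
Proof. by []. Qed.

(** The cut-off varies with the argument; locking hides it, and [opXE] replaces it by any bound N on
    the variables of f. *)
Fact opX_key : unit. Proof. exact: tt. Qed.
Definition opX := locked_with opX_key (fun n k f => opX_upto (vbound f) n k f).
Canonical opX_unlockable := [unlockable fun opX].

Lemma opX_upto_is_linear N n k : linear (opX_upto N n k).
Proof.
elim: k n => [|k IHk] n c f h; first by rewrite !opX_upto0 mulrDr scalerAr.
rewrite !opX_uptoS.
rewrite scalerA [c * _]mulrC -scalerA -scalerDr [in RHS]scaler_sumr -big_split /=; congr (_ *: _).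
apply: eq_bigr => i _.
by rewrite linearP /= IHk scalerDr !scalerA [_ * c]mulrC.
Qed.

HB.instance Definition _ N n k :=
  GRing.isLinear.Build rat A A _ (opX_upto N n k) (opX_upto_is_linear N n k).

Definition vbounded N f := forall n, (N < n)%N -> der A n f = 0.

Lemma opX_upto_vbounded N N' n k f : vbounded N f -> (N <= N')%N ->
  opX_upto N' n k f = opX_upto N n k f.
Proof.
move=> vf leN; elim: k n f vf => [|k IHk] n f vf; first by [].
rewrite !opX_uptoS; congr (_ *: _).
rewrite (big_ord_widen_cond N' predT
  (fun i => 'C(n + i.+1, n)%:R *: opX_upto N (n + i.+1) k (der A i.+1 f)) leN) [RHS]big_mkcond.
apply: eq_bigr => i _ /=; case: ltnP => [ltiN|leNi]; last by rewrite vf // linear0 scaler0.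
rewrite IHk // => m ltm; rewrite derC ?vf ?linear0 //; lia.
Qed.

Lemma opXE N n k f : vbounded N f -> opX n k f = opX_upto N n k f.
Proof.
move=> vf; rewrite unlock.
rewrite -(@opX_upto_vbounded _ (maxn N (vbound f)) n k f vf) ?leq_maxl //.
by rewrite -(@opX_upto_vbounded (vbound f) (maxn N (vbound f)) n k f) ?leq_maxr // => m; apply: der_vbound.
Qed.

Lemma opX_is_linear n k : linear (opX n k).
Proof.
move=> c f h; pose N := maxn (vbound f) (vbound h).
have vf : vbounded N f by move=> m; rewrite gtn_max => /andP[/der_vbound].
have vh : vbounded N h by move=> m; rewrite gtn_max => /andP[_ /der_vbound].
rewrite (opXE _ _ vf) (opXE _ _ vh) -linearP; apply: opXE => m ltm.
by rewrite linearP /= vf // vh // scaler0 addr0.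
Qed.

HB.instance Definition _ n k := GRing.isLinear.Build rat A A _ (opX n k) (opX_is_linear n k).

Lemma opXZ n k c f : opX n k (c *: f) = c *: opX n k f.
Proof. exact: linearZ. Qed.

Lemma opX0 n f : opX n 0 f = var A n.-1 * f.
Proof. by rewrite unlock. Qed.

Lemma opX_one n k : opX n k.+1 1 = 0.
Proof.
rewrite unlock opX_uptoS big1 ?scaler0 // => i _.
by rewrite der_one linear0 scaler0.
Qed.

Lemma binE_rat n i : 'C(n + i, n)%:R = (n + i)`!%:R / (n`!%:R * i`!%:R) :> rat.
Proof.
rewrite -(@bin_fact (n + i) n) ?leq_addr // addKn !natrM mulfK //.
by rewrite mulf_neq0 // pnatr_eq0 -lt0n fact_gt0.
Qed.

Lemma fact_neq0 n : n`!%:R != 0 :> rat.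
Proof. by rewrite pnatr_eq0 -lt0n fact_gt0. Qed.

Lemma sum_delta (G : nat -> A) N j : (0 < j)%N -> (j <= N)%N ->
  \sum_(i < N) (i.+1 == j)%:R *: G i.+1 = G j.
Proof.
case: j => // j _ ltj; rewrite (bigD1 (Ordinal ltj)) //= eqxx scale1r big1 ?addr0 // => i.
by rewrite -val_eqE /= eqSS => /negbTE ->; rewrite scale0r.
Qed.

(** Leibniz rule: any of the k+1 interchangeable derivatives may hit x_j, which turns 1/(k+1)! into
    1/k!, and the binomial coefficient trades n! j! for (n+j)!. *)
Lemma opX_var n k j f : (0 < j)%N ->
  opX n k.+1 (var A j * f) = var A j * opX n k.+1 f + 'C(n + j, n)%:R *: opX (n + j) k f.
Proof.
move=> j0; pose N := maxn j (vbound f).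
have vf : vbounded N f by move=> m; rewrite gtn_max => /andP[_ /der_vbound].
have vjf : vbounded N (var A j * f).
  move=> m ltm; have [jm fm] : (j < m /\ vbound f < m)%N by apply/andP; rewrite -gtn_max.
  rewrite der_var ?(leq_trans _ jm) // vf // gtn_eqF // mulr0 scale0r addr0 //.
rewrite (opXE _ _ vjf) !(opXE _ _ vf).
have vN : (j <= N)%N by rewrite leq_maxl.
move: N vN {vf vjf} => N jN; elim: k n f => [|k IHk] n f.
  rewrite !opX_uptoS !invr1 !scale1r mulr_sumr.
  rewrite -(sum_delta (fun i => 'C(n + i, n)%:R *: (var A (n + i).-1 * f)) j0 jN) -big_split.
  apply: eq_bigr => i _ /=; rewrite !opX_upto0 der_var // mulrDr scalerDr mulrCA scalerAr.
  by congr (_ + _); rewrite -scalerAr !scalerA mulrC.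
(* T is k+1 times [opX_upto N (n + j) k.+1 f]. Up to the common binomial factor, the inner
   derivatives hitting x_j contribute T and the outermost one T/(k+1); dividing by k+2 leaves
   T/(k+1). *)
pose T := \sum_(i < N) 'C(n + j + i.+1, n + j)%:R *: opX_upto N (n + j + i.+1) k (der A i.+1 f).
have XT : opX_upto N (n + j) k.+1 f = k.+1%:R^-1 *: T by [].
rewrite [LHS]opX_uptoS [opX_upto N n k.+2 f]opX_uptoS -scalerAr mulr_sumr.
transitivity (k.+2%:R^-1 *: (\sum_(i < N)
    var A j * ('C(n + i.+1, n)%:R *: opX_upto N (n + i.+1) k.+1 (der A i.+1 f)) +
    ('C(n + j, n)%:R *: T + 'C(n + j, n)%:R *: opX_upto N (n + j) k.+1 f))).
  congr (_ *: _).
  rewrite -(sum_delta (fun i => 'C(n + i, n)%:R *: opX_upto N (n + i) k.+1 f) j0 jN).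
  rewrite /T scaler_sumr -!big_split; apply: eq_bigr => i _ /=.
  rewrite der_var // [_ + _ *: _]addrC opX_upto_is_linear addrC IHk !scalerDr -addrA.
  congr (_ + (_ + _)); first by rewrite scalerAr.
    rewrite !scalerA; congr (_ *: _); last by rewrite addnAC.
    by rewrite !binE_rat addnAC; field; rewrite !fact_neq0.
  by rewrite scalerA [_ * (_ == _)%:R]mulrC -scalerA.
rewrite scalerDr; congr (_ + _).
rewrite -scalerDr XT -{1}(scale1r T) -scalerDl !scalerA; congr (_ *: _).
have k0 : 0 <= k%:R :> rat by [].
by field; apply/andP; split; apply: lt0r_neq0; lra.
Qed.

End Operators.

(** * Commutators *)

Section Commutators.
Context {A : derivAlg}.
Implicit Types (f h : A) (n k l m N j : nat).

(** Structure constants of the Poisson bracket with {p, t} = 1 in the basis t^n p^k / (n! k!). Where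
    a predecessor truncates at 0, the factor km - nl vanishes. *)
Definition bracket_coef n k m l : rat :=
  (k%:R * m%:R - n%:R * l%:R) * (n + m).-1`!%:R * (k + l).-1`!%:R
    / (n`!%:R * k`!%:R * m`!%:R * l`!%:R).

Lemma bracket_coefC n k m l : bracket_coef n k m l = - bracket_coef m l n k.
Proof.
rewrite /bracket_coef [(n + m)%N]addnC [(k + l)%N]addnC.
by field; rewrite !fact_neq0.
Qed.

Lemma factS_rat n : n.+1`!%:R = n.+1%:R * n`!%:R :> rat.
Proof. by rewrite factS natrM. Qed.

Lemma opX_bracket_mul n m l f : (2 <= n)%N ->
  opX n 0 (opX m l f) - opX m l (opX n 0 f)
    = bracket_coef n 0 m l *: opX (n + m).-1 l.-1 f.
Proof.
case: n => [|[|n]] // _; rewrite !opX0; case: l => [|l].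
  by rewrite !opX0 mulrCA subrr /bracket_coef mul0r mulr0 subrr !mul0r scale0r.
have e : (n.+2 + m).-1 = (m + n.+1)%N by lia.
rewrite opX_var // opprD addNKr -scaleNr /bracket_coef e /=; congr (_ *: _).
rewrite binE_rat mul0r sub0r (factS_rat n.+1) (factS_rat l).
rewrite (_ : 0`! = 1%N) //; by field; rewrite !fact_neq0 ?nat1r -?natrD ?pnatr_eq0 ?andbT.
Qed.

(** The Jacobi identity for two operators of the family and multiplication by x_j, read off on
    coefficients. *)
Lemma bracket_coef_var n k m l j : (0 < j)%N -> (0 < n + m)%N ->
  'C(n + j, n)%:R * bracket_coef (n + j) k m l.+1
    + 'C(m + j, m)%:R * bracket_coef n k.+1 (m + j) l
  = bracket_coef n k.+1 m l.+1 * 'C((n + m).-1 + j, (n + m).-1)%:R.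
Proof.
move=> j0 nm0; rewrite /bracket_coef addSn !addnS addnAC addnA -addSn /=.
have -> : (n + m + j).-1 = ((n + m).-1 + j)%N by lia.
rewrite !binE_rat !factS_rat -!natr1 !natrD.
have k1 : k%:R + 1 != 0 :> rat by rewrite natr1 pnatr_eq0.
have l1 : l%:R + 1 != 0 :> rat by rewrite natr1 pnatr_eq0.
by field; rewrite !fact_neq0 k1 l1.
Qed.

(* Writing p_n for d/dx_n and p(t) for the sum of the p_n t^n / n!, [opX n k]   *)
(* acts as the vector field p(t) |-> d/dt H(t, p(t)) with H = t^n p^k / (n! k!), *)
(* and the commutator corresponds to the Poisson bracket of Hamiltonians.       *)
Lemma opX_bracket n k m l f : (2 <= n + k)%N -> (2 <= m + l)%N ->
  opX n k (opX m l f) - opX m l (opX n k f)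
    = bracket_coef n k m l *: opX (n + m).-1 (k + l).-1 f.
Proof.
(* Commuting with a variable lowers k or l by one, hence an induction on k + l with an inner
   induction on f. *)
have [N] := ubnP (k + l); elim: N n k m l f => // N IHN n k m l f leN nk ml.
have [k0|k_gt0] := posnP k.
  by rewrite {}k0 addn0 in nk *; rewrite opX_bracket_mul.
have [l0|l_gt0] := posnP l.
  rewrite {}l0 !addn0 in ml *; rewrite -opprB opX_bracket_mul // bracket_coefC scaleNr.
  by rewrite opprK [(m + n)%N]addnC.
case: k l k_gt0 l_gt0 nk ml leN => [|k] [|l] // _ _ nk ml leN.
elim/derivAlg_ind: f => [|c f h ef eh|j f j0 ef].
- by rewrite !opX_one !linear0 addr0 addnS opX_one scaler0.
- by rewrite !opX_is_linear opprD addrACA -scalerN -scalerDr ef eh scalerDr !scalerA mulrC.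
rewrite !opX_var // !linearD /= !opX_var // !linearZ /=.
set a := 'C(n + j, n)%:R; set b := 'C(m + j, m)%:R.
transitivity (var A j * (opX n k.+1 (opX m l.+1 f) - opX m l.+1 (opX n k.+1 f))
   + (a *: (opX (n + j) k (opX m l.+1 f) - opX m l.+1 (opX (n + j) k f))
     + b *: (opX n k.+1 (opX (m + j) l f) - opX (m + j) l (opX n k.+1 f)))).
  rewrite mulrBr !scalerBr opprD; ring.
rewrite ef !IHN; try lia.
rewrite /a /b !scalerA [(n + j + m)%N]addnAC [(n + (m + j))%N]addnA.
have -> : (k + l.+1).-1 = (k + l)%N by lia.
have -> : (k.+1 + l).-1 = (k + l)%N by lia.
have -> : (k.+1 + l.+1).-1 = (k + l).+1 by lia.
(* For n = m = 0 the index [(n + m).-1] is truncated; there the two new contributions cancel and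
   both sides are zero. *)
have [nm0|nm_gt0] := posnP (n + m).
  have [-> ->] : n = 0%N /\ m = 0%N by lia.
  rewrite -scalerDl /bracket_coef !mul0r !mulr0 subrr !mul0r !scale0r mulr0 add0r.
  rewrite (_ : _ + _ = 0) ?scale0r // !add0n !bin0 !mul1r addSn addnS /=.
  rewrite addn0 (_ : 0`! = 1%N) // !factS_rat.
  by field; rewrite !fact_neq0 ?nat1r ?pnatr_eq0.
have -> : (n + m + j).-1 = ((n + m).-1 + j)%N by lia.
by rewrite addnS opX_var // -scalerDl bracket_coef_var // scalerDr scalerA scalerAr.
Qed.

Lemma opX_comm k l f : (2 <= k)%N -> (2 <= l)%N ->
  opX 0 k (opX 0 l f) = opX 0 l (opX 0 k f).
Proof.
move=> k2 l2; apply/eqP; rewrite -subr_eq0 opX_bracket //.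
by rewrite /bracket_coef mulr0 mul0r subrr !mul0r scale0r.
Qed.

(** The variable in front has index at least n + k - 1 >= 2, so d/dx_1 never hits it. *)
Lemma der1_opX n k f : (3 <= n + k)%N -> der A 1 (opX n k f) = opX n k (der A 1 f).
Proof.
elim: k n f => [|k IHk] n f nk.
  have [n1 n1_neq] : (0 < n.-1)%N /\ (1 == n.-1)%N = false by lia.
  by rewrite !opX0 der_var // n1_neq scale0r addr0.
elim/derivAlg_ind: f => [|c f h ef eh|j f j0 ef].
- by rewrite opX_one der_one !linear0.
- by rewrite opX_is_linear !linearP /= ef eh.
have nj : (3 <= n + j + k)%N by lia.
rewrite opX_var // linearD linearZ /= IHk // !der_var // ef.
by rewrite [_ + _ *: f]addrC opX_is_linear opX_var // addrAC [LHS]addrC addrA.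
Qed.

Lemma der1_opX11 f : der A 1 (opX 1 1 f) = opX 1 1 (der A 1 f) + 2 *: der A 1 f.
Proof.
elim/derivAlg_ind: f => [|c f h ef eh|j f j0 ef].
- by rewrite opX_one der_one !linear0 addr0.
- by rewrite opX_is_linear !linearP /= ef eh !scalerDr addrACA [c *: (2 *: _)]scalerA [c * 2]mulrC -scalerA.
rewrite opX_var // opX0 linearD linearZ /= !der_var // ef.
have [<-|j_neq1] := eqVneq 1%N j.
  rewrite !scale1r [opX 1 1 (_ + f)]linearD /= add0n opX_var // opX0.
  by rewrite mulrDr -scalerAr [_ + _ + opX 1 1 f]addrAC.
rewrite !scale0r !addr0 opX_var // opX0 mulrDr -scalerAr addrAC.
by [].
Qed.

(** The only term of D_2 containing the variable x_1 as coefficient is x_1 d_1^2, whence [d_1, D_2]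
    = d_1^2. The induction on f also needs the commutator with [opX 1 1], which arises from a factor
    x_1. *)
Lemma der1_opX02 f : der A 1 (opX 0 2 f) = opX 0 2 (der A 1 f) + der A 1 (der A 1 f).
Proof.
elim/derivAlg_ind: f => [|c f h ef eh|j f j0 ef].
- by rewrite opX_one der_one !linear0 addr0.
- by rewrite opX_is_linear !linearP /= ef eh !scalerDr addrACA.
rewrite opX_var // bin0 scale1r add0n linearD /= !der_var // ef mulrDr.
have [<-|j_neq1] := eqVneq 1%N j.
  rewrite !scale1r !linearD /= der_var // eqxx scale1r opX_var // bin0 scale1r add0n der1_opX11.
  rewrite (_ : 2 *: _ = der A 1 f + der A 1 f); last by rewrite scaler_nat mulr2n.
  rewrite -!addrA; congr (_ + _); rewrite addrCA [in RHS]addrCA.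
  by congr (_ + _); rewrite addrCA.
rewrite !scale0r !addr0 opX_var // bin0 scale1r add0n der1_opX; last by lia.
by rewrite der_var // (negbTE j_neq1) scale0r addr0 addrAC.
Qed.

End Commutators.

(** * Action on products of variables *)

Lemma finset_ind (T : finType) (P : {set T} -> Prop) :
    P set0 -> (forall (U : {set T}) i, i \notin U -> P U -> P (i |: U)) ->
  forall U, P U.
Proof.
move=> P0 PU U; have [n] := ubnP #|U|; elim: n U => // n IHn U.
have [-> //|[i iU]] := set_0Vmem U.
by rewrite (cardsD1 i) iU => /IHn PUi; rewrite -(setD1K iU); apply: PU; rewrite ?setD11.
Qed.

Lemma big_subset_setU1 (I : finType) (V : nmodType) (U : {set I}) (i : I)
    (F : {set I} -> V) : i \notin U ->
  \sum_(B : {set I} | B \subset i |: U) F B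
    = \sum_(B : {set I} | B \subset U) F B + \sum_(B : {set I} | B \subset U) F (i |: B).
Proof.
move=> iU; rewrite (bigID (fun B : {set I} => i \notin B)) /=; congr (_ + _).
  apply: eq_bigl => B; rewrite -subsetD1 setU1K //.
rewrite (reindex_onto (fun B => i |: B) (fun B => B :\ i)) /=; last first.
  by move=> B /andP[_]; rewrite negbK => iB; rewrite setD1K.
apply: eq_bigl => B; rewrite setU11 /= andbT.
apply/andP/idP => [[sB /eqP e]|sB].
  rewrite -e subDset; apply: subset_trans sB _ => //.
rewrite setUS // setU1K //; apply: contra iU; exact: (subsetP sB).
Qed.

(** Valid at every integer: at z = -1 the vanishing of the divided power is matched by the factor z
    + 1. Integer exponents thus make truncation automatic. *)
Lemma divpow_S (R : comAlgType rat) (p : R) (z : int) :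
  p * divpow p z = (z + 1)%:~R *: divpow p (z + 1).
Proof.
case: z => [n|[|n]]; last 2 first.
- by rewrite [divpow p (Negz _)]/= mulr0 (_ : Negz 0 + 1 = 0) // scale0r.
- by rewrite [divpow p (Negz _)]/= mulr0 (_ : Negz n.+1 + 1 = Negz n) /= ?scaler0 //; lia.
rewrite (_ : Posz n + 1 = Posz n.+1); last by lia.
rewrite -[(Posz _)%:~R]/(n.+1%:R) -[divpow p n.+1]/((n.+1`!%:R)^-1 *: p ^+ n.+1).
rewrite scalerA factS_rat invfM mulrA divff ?pnatr_eq0 // mul1r.
by rewrite -scalerAr exprS.
Qed.

Section Products.
Context {A : derivAlg}.
Local Notation dp := (divpow (var A 1)).

Lemma opX_divpow n k (z : int) :
  opX n k (dp z) = 'C(n + k, n)%:R *: (var A (n + k).-1 * dp (z - k%:Z)).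
Proof.
case: z => [a|a]; last first.
  by rewrite (_ : Negz a - _ = Negz (a + k)) /= ?linear0 ?mulr0 ?scaler0 //; lia.
elim: a n k => [|a IHa] n [|k].
- by rewrite opX0 addn0 binn scale1r subr0.
- rewrite [dp 0]/= scale1r expr0 opX_one (_ : 0%:Z - _ = Negz k) /= ?mulr0 ?scaler0 //; lia.
- by rewrite opX0 addn0 binn scale1r subr0.
have a1 : a.+1%:R != 0 :> rat by rewrite pnatr_eq0.
have dpS : a.+1%:R *: dp a.+1 = var A 1 * dp a.
  by rewrite divpow_S (_ : Posz a + 1 = Posz a.+1) //; lia.
apply: (scalerI a1); rewrite -opXZ dpS opX_var // !IHa -scalerAr mulrCA divpow_S.
have -> : a%:Z - k.+1%:Z + 1 = a%:Z - k%:Z by lia.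
have -> : a.+1%:Z - k.+1%:Z = a%:Z - k%:Z by lia.
have -> : (n + k.+1).-1 = (n + k)%N by lia.
have -> : (n + 1 + k).-1 = (n + k)%N by lia.
rewrite -!scalerAr !scalerA -scalerDl; congr (_ *: _).
rewrite rmorphB /= !binE_rat; have -> : (n + 1 + k = n + k.+1)%N by lia.
rewrite addn1 !factS_rat -!natr1 -!pmulrn.
by field; rewrite !fact_neq0 ?natr1 ?pnatr_eq0.
Qed.

(** Here b of the k derivatives hit chosen factors of total index N and the other k - b hit the
    power of x_1; the factorials of the chosen indices are kept outside. *)
Definition opX_coef n k N b : rat :=
  if (b <= k)%N then (n + N + (k - b))`!%:R / (n`!%:R * (k - b)`!%:R) else 0.

(** B is the set of factors hit by a derivative; each is hit once, and all other derivatives hit the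
    divided power of x_1. *)
Lemma opX_prod (I : finType) (nu : I -> nat) (U : {set I}) n k (z : int) :
    (forall i, i \in U -> 0 < nu i)%N ->
  opX n k (dp z * \prod_(i in U) var A (nu i)) =
  \sum_(B : {set I} | B \subset U)
    (opX_coef n k (\sum_(i in B) nu i) #|B| / \prod_(i in B) (nu i)`!%:R) *:
      (var A (n + \sum_(i in B) nu i + (k - #|B|)).-1 * dp (z - (k%:Z - #|B|%:Z))
        * \prod_(i in U :\: B) var A (nu i)).
Proof.
elim/finset_ind: U n k => [|U i iU IHU] n k nuU.
  rewrite big_set0 mulr1 (big_pred1 set0) => [|B]; last by rewrite subset0.
  rewrite opX_divpow binE_rat /opX_coef !big_set0 setD0 big_set0 mulr1 divr1.
  by rewrite cards0 leq0n !subn0 addn0 subr0.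
have {}IHU n' k' := IHU n' k' (fun j jU => nuU j (setU1r i jU)).
have nui : (0 < nu i)%N by apply/nuU/setU11.
rewrite big_setU1 //= mulrCA big_subset_setU1 //.
have -> m : opX m k (var A (nu i) * (dp z * \prod_(i in U) var A (nu i))) =
    var A (nu i) * opX m k (dp z * \prod_(i in U) var A (nu i)) +
    (if k is k'.+1 then 'C(m + nu i, m)%:R *: opX (m + nu i) k' (dp z * \prod_(i in U) var A (nu i))
     else 0).
  by case: k => [|k]; rewrite ?opX_var // !opX0 addr0 mulrCA.
congr (_ + _).
  rewrite IHU mulr_sumr; apply: eq_bigr => B sB; rewrite -scalerAr; congr (_ *: _).
  have iB : i \notin B by apply: contra iU; exact: (subsetP sB).
  have -> : (i |: U) :\: B = i |: (U :\: B).
    by apply/setP => j; rewrite !inE; case: eqP => [->|]; rewrite ?iB.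
  by rewrite big_setU1 /= ?inE ?(negbTE iU) ?andbF // mulrCA.
case: k => [|k].
  rewrite big1 // => B sB; have iB : i \notin B by apply: contra iU; exact: (subsetP sB).
  by rewrite /opX_coef cardsU1 iB mul0r scale0r.
rewrite IHU scaler_sumr; apply: eq_bigr => B sB.
have iB : i \notin B by apply: contra iU; exact: (subsetP sB).
rewrite scalerA !big_setU1 //= cardsU1 iB add1n subSS.
rewrite [(n + (nu i + _))%N]addnA.
have -> : (k.+1%:Z - #|B|.+1%:Z) = k%:Z - #|B|%:Z by lia.
have -> : (i |: U) :\: (i |: B) = U :\: B.
  by apply/setP => j; rewrite !inE; case: eqP => [->|]; rewrite ?(negbTE iU) ?andbF.
congr (_ *: _); rewrite /opX_coef ltnS; case: leqP => [leBk|]; last by rewrite !mul0r mulr0.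
rewrite binE_rat subSS addnA; field.
rewrite !fact_neq0 /= andbT; apply/prodf_neq0 => j _; exact: fact_neq0.
Qed.

End Products.

(** * Descent to the quotient *)

Lemma sum_subset_card (I J : finType) (U : {set I}) (V : {set J}) (G : nat -> rat) :
  #|U| = #|V| ->
  \sum_(B : {set I} | B \subset U) G #|B| = \sum_(B : {set J} | B \subset V) G #|B|.
Proof.
elim/finset_ind: U V => [|U i iU IHU] V in G *.
  rewrite cards0 => /esym/eqP; rewrite cards_eq0 => /eqP ->.
  by rewrite !(big_pred1 set0) ?cards0 // => B; rewrite subset0.
rewrite cardsU1 iU add1n => cV.
have [j jV] : exists j, j \in V by apply/card_gt0P; rewrite -cV.
have {}cV : #|U| = #|V :\ j| by move: cV; rewrite (cardsD1 j V) jV => -[].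
rewrite -(setD1K jV) !big_subset_setU1 ?setD11 //; congr (_ + _); first exact: IHU.
transitivity (\sum_(B : {set I} | B \subset U) G #|B|.+1).
  apply: eq_bigr => B sB; rewrite cardsU1 (_ : i \notin B) //.
  by apply: contra iU; apply: (subsetP sB).
rewrite (IHU _ (fun n => G n.+1) cV); apply: eq_bigr => B sB; rewrite cardsU1 (_ : j \notin B) //.
by apply/negP => /(subsetP sB); rewrite setD11.
Qed.

(** Double counting of pairs j in B: by [sum_subset_card], the inner sum is the same for every j in
    U, so it may be taken at i. *)
Lemma sum_subset_weight (I : finType) (U : {set I}) (i : I) (nu : I -> nat) (G : nat -> rat) :
    i \in U ->
  \sum_(B : {set I} | B \subset U) (\sum_(j in B) nu j)%:R * G #|B|
    = (\sum_(j in U) nu j)%:R * \sum_(B : {set I} | B \subset U :\ i) G #|B|.+1.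
Proof.
move=> iU; rewrite natr_sum mulr_suml.
transitivity (\sum_(j in U) \sum_(B : {set I} | (B \subset U) && (j \in B)) (nu j)%:R * G #|B|).
  rewrite (exchange_big_dep (fun B : {set I} => B \subset U)) /=; last by move=> j B _ /andP[].
  apply: eq_bigr => B sB; rewrite natr_sum mulr_suml; apply: eq_bigl => j.
  by rewrite sB; case jB: (j \in B); rewrite ?andbF ?(subsetP sB _ jB).
apply: eq_bigr => j jU; rewrite -mulr_sumr; congr (_ * _).
transitivity (\sum_(B : {set I} | B \subset U :\ j) G #|B|.+1); last first.
  by apply: (sum_subset_card (fun n => G n.+1)); move: (cardsD1 i U) (cardsD1 j U); rewrite iU jU => -> [].
rewrite (reindex_onto (fun B => j |: B) (fun B => B :\ j)) /=; last first.
  by move=> B /andP[_ jB]; rewrite setD1K.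
apply: eq_big => [B|B]; last first.
  by move=> /andP[_ /eqP e]; rewrite cardsU1 (_ : j \notin B) // -e setD11.
rewrite setU11 andbT; apply/andP/idP => [[sB /eqP <-]|]; first exact: setSD.
rewrite subsetD1 => /andP[sB jB]; rewrite setU1K // eqxx subUset sub1set jU sB //.
Qed.

Section Spans.
Context {V : lmodType rat}.
Implicit Types (G : V -> Prop) (f h : V).

Inductive spanned G : V -> Prop :=
  | spanned0 : spanned G 0
  | spannedP c f h : G f -> spanned G h -> spanned G (c *: f + h).

Lemma spanned_gen G f : G f -> spanned G f.
Proof. by move=> Gf; rewrite -[f]addr0 -[f]scale1r; apply: spannedP => //; apply: spanned0. Qed.

Lemma spannedD G f h : spanned G f -> spanned G h -> spanned G (f + h).
Proof.
move=> Gf Gh; elim: Gf => [|c f' h' Gf' _ IH]; first by rewrite add0r.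
by rewrite -addrA; apply: spannedP.
Qed.

Lemma spannedZ G c f : spanned G f -> spanned G (c *: f).
Proof.
elim=> [|d f' h' Gf' _ IH]; first by rewrite scaler0; apply: spanned0.
by rewrite scalerDr scalerA; apply: spannedP.
Qed.

Lemma spanned_sum G (I : Type) (r : seq I) (P : pred I) (F : I -> V) :
  (forall i, P i -> spanned G (F i)) -> spanned G (\sum_(i <- r | P i) F i).
Proof.
move=> GF; elim/big_rec: _ => [|i f Pi Gf]; first exact: spanned0.
by apply: spannedD => //; apply: GF.
Qed.

End Spans.

Lemma spanned_map (V W : lmodType rat) (F : {linear V -> W}) (G : V -> Prop) (H : W -> Prop) f :
  (forall f, G f -> spanned H (F f)) -> spanned G f -> spanned H (F f).
Proof.
move=> GH; elim=> [|c f' h' Gf' _ IH]; first by rewrite linear0; apply: spanned0.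
by rewrite linearP; apply: spannedD => //; apply/spannedZ/GH.
Qed.

(** * The operator D and its image in degree g-1 *)

Section Descent.
Context {A : derivAlg}.
Implicit Types (f h : A) (g k n : nat) (z : int).
Local Notation dp := (divpow (var A 1)).

Definition opD g f := opX 0 2 f - g%:R *: der A 1 f.

Lemma opD_is_linear g : linear (opD g).
Proof.
move=> c f h; rewrite /opD opX_is_linear linearP /= scalerDr opprD addrACA scalerBr.
by congr (_ - _ + _); rewrite !scalerA mulrC.
Qed.

HB.instance Definition _ g := GRing.isLinear.Build rat A A _ (opD g) (opD_is_linear g).

Lemma opDZ g c f : opD g (c *: f) = c *: opD g f.
Proof. exact: linearZ. Qed.

Lemma opX_opD k g f : (3 <= k)%N -> opX 0 k (opD g f) = opD g (opX 0 k f).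
Proof.
move=> k3; rewrite /opD linearB linearZ /= (opX_comm _ _ (ltnW k3)) // der1_opX //.
Qed.

(** The relation [d_1, D_2] = d_1^2 shifts the coefficient of d_1 by one, so d_1 relates D for g+1
    to D for g. *)
Lemma der1_opD g f : der A 1 (opD g.+1 f) = opD g (der A 1 f).
Proof.
rewrite /opD linearB linearZ /= der1_opX02 -natr1 scalerDl scale1r opprD addrA.
by rewrite addrAC addrK.
Qed.

Lemma der1_divpow z f : der A 1 (dp z * f) = dp (z - 1) * f + dp z * der A 1 f.
Proof.
case: z => [n|n]; last by rewrite (_ : Negz n - 1 = Negz n.+1) /= ?mul0r ?linear0 ?addr0 //; lia.
elim: n f => [|n IHn] f.
  by rewrite /= mul0r add0r !scale1r !mul1r.
have n1 : n.+1%:R != 0 :> rat by rewrite pnatr_eq0.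
have dpS h : n.+1%:R *: (dp n.+1 * h) = var A 1 * (dp n * h).
  by rewrite mulrA divpow_S scalerAl (_ : Posz n + 1 = Posz n.+1) //; lia.
apply: (scalerI n1); rewrite -linearZ dpS der_var // IHn eqxx scale1r scalerDr dpS.
rewrite (_ : Posz n.+1 - 1 = n) ?mulrDr; last by lia.
rewrite addrAC; congr (_ + _).
by rewrite mulrA divpow_S subrK -scalerAl -{2}[dp n * f]scale1r -scalerDl natr1.
Qed.

Lemma der1_prod (I : finType) (nu : I -> nat) (U : {set I}) :
  (forall i, i \in U -> 1 < nu i)%N -> der A 1 (\prod_(i in U) var A (nu i)) = 0.
Proof.
move=> nuU; elim/big_rec: _ => [|i f iU df]; first exact: der_one.
have nui := nuU i iU.
by rewrite der_var ?df ?mulr0 ?add0r ?(ltn_eqF nui) ?scale0r // ltnW.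
Qed.

(** Up to scalars, the monomials of degree g other than x_1^g. The index type is arbitrary so that a
    merged factor can be added as [None] in an option type. *)
Definition lowmon g f := exists (I : finType) (U : {set I}) (nu : I -> nat) (a : nat),
  [/\ U != set0, forall i, i \in U -> (1 < nu i)%N, (a + \sum_(i in U) nu i)%N = g
    & f = dp a * \prod_(i in U) var A (nu i)].

(* The degree g-1 part of I_g.                                                 *)
Definition lowD g f := exists2 w, spanned (lowmon g) w & f = opD g w.

Lemma lowD0 g : lowD g 0.
Proof. by exists 0; [exact: spanned0 | rewrite linear0]. Qed.

Lemma lowDD g f h : lowD g f -> lowD g h -> lowD g (f + h).
Proof.
by move=> [w lw ->] [w' lw' ->]; exists (w + w'); [exact: spannedD | rewrite linearD].
Qed.

Lemma lowDZ g c f : lowD g f -> lowD g (c *: f).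
Proof. by move=> [w lw ->]; exists (c *: w); [exact: spannedZ | rewrite linearZ]. Qed.

Lemma lowDB g f h : lowD g f -> lowD g h -> lowD g (f - h).
Proof. by move=> lf lh; rewrite -scaleN1r; apply/lowDD/lowDZ. Qed.

Lemma lowD_sum g (I : Type) (r : seq I) (P : pred I) (F : I -> A) :
  (forall i, P i -> lowD g (F i)) -> lowD g (\sum_(i <- r | P i) F i).
Proof.
move=> GF; elim/big_rec: _ => [|i f Pi Gf]; first exact: lowD0.
by apply: lowDD => //; apply: GF.
Qed.

End Descent.

(** * Normal form of monomials of degree g-1 modulo the image of D *)

Section NormalForm.
Context {A : derivAlg}.
Implicit Types (f h : A) (g k n : nat) (z : int).
Local Notation dp := (divpow (var A 1)).

Lemma prod_fact_neq0 (I : finType) (P : pred I) (nu : I -> nat) :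
  \prod_(i | P i) (nu i)`!%:R != 0 :> rat.
Proof. by apply/prodf_neq0 => i _; apply: fact_neq0. Qed.

(* In degree g-1, a monomial x_1^[b] M with M a product of t+1 factors depends, *)
(* modulo [lowD g] and up to a scalar, only on the degree of M minus t.         *)
Definition reduces t := forall g (I : finType) (U : {set I}) (nu : I -> nat) (b : nat),
  #|U| = t.+1 -> (forall i, i \in U -> (1 < nu i)%N) -> (b + \sum_(i in U) nu i).+1 = g ->
  lowD g (dp b * \prod_(i in U) var A (nu i)
    - ((-1) ^+ t * ((\sum_(i in U) nu i)`!%:R / \prod_(i in U) (nu i)`!%:R))
      *: (dp (b + t)%N * var A (\sum_(i in U) nu i - t))).

Lemma big_optionU1 (I : finType) (U : {set I}) (R : Type) (idx : R) (op : Monoid.com_law idx)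
    (F : option I -> R) :
  \big[op/idx]_(i in None |: [set Some i | i in U]) F i
    = op (F None) (\big[op/idx]_(i in U) F (Some i)).
Proof.
rewrite big_setU1 /=; last by apply/imsetP => -[].
by rewrite big_imset //= => i j _ _ [].
Qed.

(** [reduces] with one factor singled out: x_c is the variable created by merging, placed at the
    index [None]. *)
Lemma reduces_cons t g (I : finType) (U : {set I}) (nu : I -> nat) (b c : nat) :
    reduces t -> #|U| = t -> (1 < c)%N -> (forall i, i \in U -> (1 < nu i)%N) ->
    (b + (c + \sum_(i in U) nu i)).+1 = g ->
  lowD g (dp b * (var A c * \prod_(i in U) var A (nu i))
    - ((-1) ^+ t * ((c + \sum_(i in U) nu i)`!%:R / (c`!%:R * \prod_(i in U) (nu i)`!%:R)))
      *: (dp (b + t)%N * var A (c + \sum_(i in U) nu i - t))).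
Proof.
move=> red_t cardU c1 nuU eg.
pose nu' (o : option I) := if o is Some i then nu i else c.
have := red_t g _ (None |: [set Some i | i in U]) nu' b.
rewrite !big_optionU1 /=; apply => //.
  rewrite cardsU1 card_imset ?cardU ?add1n //; last by move=> i j [].
  by case: imsetP => // -[].
move=> o; rewrite !inE; case: o => [i|] //= /imsetP[j jU [->]]; exact: nuU.
Qed.

Lemma sum_ge_card (I : finType) (nu : I -> nat) (U B : {set I}) :
  (forall i, i \in U -> (1 < nu i)%N) -> B \subset U -> (#|B|.*2 <= \sum_(i in B) nu i)%N.
Proof.
move=> nuU sB; rewrite -muln2 -sum_nat_const; apply: leq_sum => i iB.
exact/nuU/(subsetP sB).
Qed.

Lemma sum_subset_card_eq (I : finType) (V : {set I}) r :
  \sum_(B : {set I} | B \subset V) (#|B| == r)%:R = 'C(#|V|, r)%:R :> rat.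
Proof.
rewrite -cards_draws -sum1_card natr_sum [RHS]big_mkcond [LHS]big_mkcond /=.
by apply: eq_bigr => B _; rewrite !inE; case: (B \subset V); case: eqP.
Qed.

Lemma sum_nat_setD (I : finType) (U B : {set I}) (nu : I -> nat) : B \subset U ->
  (\sum_(i in U) nu i = \sum_(i in B) nu i + \sum_(i in U :\: B) nu i)%N.
Proof. by move=> sB; rewrite (big_setID B) /= (setIidPr sB). Qed.

Lemma prod_setD (R : comPzRingType) (I : finType) (U B : {set I}) (F : I -> R) : B \subset U ->
  \prod_(i in U) F i = \prod_(i in B) F i * \prod_(i in U :\: B) F i.
Proof. by move=> sB; rewrite (big_setID B) /= (setIidPr sB). Qed.

(* D(x_1^[b+1] M) is t+1 times x_1^[b] M plus terms in which two factors of M   *)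
(* are merged into one.                                                         *)
Lemma reducesS t : reduces t -> reduces t.+1.
Proof.
move=> red_t g I U nu b cardU nuU eg; set N := (\sum_(i in U) nu i)%N in eg *.
set mon := _ * \prod_(i in U) _; set X := dp _ * var A _.
set pU := \prod_(i in U) (nu i)`!%:R.
have [i0 i0U] : exists i, i \in U by apply/card_gt0P; rewrite cardU.
pose w := dp b.+1 * \prod_(i in U) var A (nu i).
have lw : spanned (lowmon g) w.
  apply: spanned_gen; exists I, U, nu, b.+1; split => //.
  by apply/set0Pn; exists i0.
have nuU0 i : i \in U -> (0 < nu i)%N by move/nuU/ltnW.
(* For #|B| = 0 or 1, a derivative still hits the power of x_1 and [mon] reappears with coefficient
   b or nu_i + 1. For #|B| = 2 two factors merge, and the induction hypothesis turns the term into a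
   multiple of X. *)
pose a (B : {set I}) : rat := (#|B| == 0%N)%:R * b%:R + (#|B| == 1%N)%:R * ((\sum_(i in B) nu i).+1)%:R.
pose c (B : {set I}) : rat := (#|B| == 2%N)%:R * ((-1) ^+ t * (N.-1)`!%:R * (\sum_(i in B) nu i)%:R / pU).
have termP (B : {set I}) : B \subset U -> lowD g (
    (opX_coef 0 2 (\sum_(i in B) nu i) #|B| / \prod_(i in B) (nu i)`!%:R) *:
      (var A (0 + \sum_(i in B) nu i + (2 - #|B|)).-1 * dp (b.+1%:Z - (2%:Z - #|B|%:Z))
        * \prod_(i in U :\: B) var A (nu i)) - (a B *: mon + c B *: X)).
  move=> sB; rewrite /a /c /opX_coef; case: (ltngtP #|B| 2) => [| B3|B2].
  - case: (posnP #|B|) => [B0 _|B_gt0 B_lt2].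
      have -> : B = set0 by apply/eqP; rewrite -cards_eq0 B0.
      rewrite !big_set0 setD0 divr1 cards0 /= !mul0r !scale0r !addr0 mul1r (_ : _ / _ = 1) // scale1r.
      rewrite divpow_S (_ : b.+1%:Z - _ + 1 = b%:Z); last by lia.
      by rewrite -scalerAl mul1r -pmulrn subrr; apply: lowD0.
    have /eqP B1 : #|B| == 1%N by rewrite eqn_leq B_gt0 -ltnS B_lt2.
    move: (B1) sB => /eqP/cards1P[i ->]; rewrite sub1set cards1 !big_set1 => iU.
    have -> : b.+1%:Z - (2%:Z - 1%:Z) = b%:Z by lia.
    rewrite subSn // subnn addn1 add0n !mul0r add0r mul1r scale0r addr0 mul1r mulr1.
    rewrite factS_rat mulfK ?fact_neq0 // (_ : _ * _ * _ = mon) ?subrr; first exact: lowD0.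
    by rewrite /mon (big_setD1 i iU) /= [in RHS]mulrCA mulrA.
  - have [-> ->] : (#|B| == 0%N) = false /\ (#|B| == 1%N) = false by lia.
    by rewrite !mul0r addr0 !scale0r addr0 subr0; apply: lowD0.
  rewrite B2 !mul0r addr0 scale0r add0r mul1r subnn addn0 add0n mul1r divr1.
  have cUB : #|U :\: B| = t by rewrite cardsD (setIidPr sB) cardU B2; lia.
  have nuUB i : i \in U :\: B -> (1 < nu i)%N by rewrite inE => /andP[_ /nuU].
  have B4 : (4 <= \sum_(i in B) nu i)%N by have := sum_ge_card nuU sB; rewrite B2.
  have NB : N = (\sum_(i in B) nu i + \sum_(i in U :\: B) nu i)%N by apply: sum_nat_setD.
  have c1 : (1 < (\sum_(i in B) nu i).-1)%N by lia.
  have wt : (b.+1 + ((\sum_(i in B) nu i).-1 + \sum_(i in U :\: B) nu i)).+1 = g by lia.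
  have := lowDZ ((\sum_(i in B) nu i)`!%:R / \prod_(i in B) (nu i)`!%:R)
    (reduces_cons red_t cUB c1 nuUB wt).
  have -> : ((\sum_(i in B) nu i).-1 + \sum_(i in U :\: B) nu i = N.-1)%N by lia.
  rewrite addSn -addnS scalerBr scalerA (_ : N.-1 - t = N - t.+1)%N -/X; last by lia.
  rewrite (mulrCA (dp _)) mulrA.
  suff -> : (-1) ^+ t * N.-1`!%:R * (\sum_(i in B) nu i)%:R / pU =
    (\sum_(i in B) nu i)`!%:R / (\prod_(i in B) (nu i)`!%:R) *
     ((-1) ^+ t * (N.-1`!%:R / ((\sum_(i in B) nu i).-1`!%:R * \prod_(i in U :\: B) (nu i)`!%:R))) by [].
  rewrite /pU (prod_setD _ sB) -[in RHS](prednK (ltnW (ltnW (ltnW B4)))) factS_rat prednK; last by lia.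
  by field; rewrite !prod_fact_neq0 fact_neq0.
have sum_a : \sum_(B : {set I} | B \subset U) a B = b%:R + N%:R + t.+2%:R.
  rewrite /a; rewrite big_split /=.
  under [X in _ + X]eq_bigr => B _ do rewrite -natr1 mulrDr mulr1 mulrC.
  rewrite big_split /= (sum_subset_weight _ (fun n => (n == 1%N)%:R) i0U) -/N.
  under [X in _ + (_ * X + _)]eq_bigr => B _ do rewrite eqSS.
  rewrite -mulr_suml !sum_subset_card_eq !bin0 bin1 cardU.
  by rewrite mul1r mulr1 addrA.
have sum_c : \sum_(B : {set I} | B \subset U) c B = t.+1%:R * ((-1) ^+ t * N`!%:R / pU).
  transitivity ((-1) ^+ t * N.-1`!%:R / pU *
      \sum_(B : {set I} | B \subset U) (\sum_(i in B) nu i)%:R * (#|B| == 2)%:R).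
    by rewrite mulr_sumr; apply: eq_bigr => B _; rewrite /c; field; exact: prod_fact_neq0.
  rewrite (sum_subset_weight _ (fun n => (n == 2)%:R) i0U) -/N.
  under [X in _ * (N%:R * X)]eq_bigr => B _ do rewrite eqSS.
  have cU : #|U :\ i0| = t.+1 by move: cardU; rewrite (cardsD1 i0 U) i0U => -[].
  have N_gt0 : (0 < N)%N.
    by rewrite /N (bigD1 i0) //= addn_gt0 nuU0.
  rewrite sum_subset_card_eq cU bin1 -[in RHS](prednK N_gt0) factS_rat (prednK N_gt0).
  by field; exact: prod_fact_neq0.
have dw : der A 1 w = mon.
  rewrite der1_divpow der1_prod // mulr0 addr0 (_ : b.+1%:Z - 1 = b%:Z) //; lia.
have := lowD_sum (index_enum _) termP; rewrite sumrB -(opX_prod 0 2 b.+1%:Z nuU0) -/w.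
rewrite big_split /= -!scaler_suml sum_a sum_c => lX.
have lDw : lowD g (opX 0 2 w - g%:R *: mon) by exists w; rewrite // /opD dw.
have t1 : t.+1%:R != 0 :> rat by rewrite pnatr_eq0.
have := lowDZ (t.+1%:R^-1) (lowDB lDw lX).
rewrite opprB [opX 0 2 w - _ + _]addrC subrKA addrAC -scalerBl scalerDr !scalerA.
(* The coefficient of [mon] in D(w) is (b + N + t + 2) - g, which equals t + 1 because g = b + N +
   1; hence one can divide by it. *)
rewrite (_ : _^-1 * (_ - _) = 1); last first.
  rewrite (_ : _ - _ = t.+1%:R) ?mulVf // -eg.
  by rewrite -[(b + N).+1%:R]natr1 natrD -[t.+2%:R]natr1; ring.
rewrite scale1r mulKf // -scaleNr; congr (lowD g (_ + _ *: _)).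
by rewrite exprS mulN1r mulNr opprK ?mulrA.
Qed.

Lemma reduces_all t : reduces t.
Proof.
elim: t => [|t]; last exact: reducesS.
move=> g I U nu b /eqP/cards1P[i ->] _ _; rewrite !big_set1 subn0 addn0 expr0.
by rewrite divff ?fact_neq0 // mulr1 scale1r subrr; apply: lowD0.
Qed.

(** For b < k this is the ratio (N + k - b - 1) G(b+1) = -(k - b) G(b) of consecutive values; beyond
    k every term is zero. *)
Lemma falling_step N k b : (0 < N)%N ->
  let G j : rat := if (j <= k)%N then (-1) ^+ j * ((N + (k - j)).-1)`!%:R / (k - j)`!%:R else 0 in
  N%:R * G b.+1 + (k%:R - b%:R) * G b + (k%:R - b.+1%:R) * G b.+1 = 0.
Proof.
move=> N0 G; rewrite /G; case: (ltngtP b k) => [bk|kb|->].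
- have [q ->] : exists q, k = (b + q).+1.
    by exists (k - b.+1)%N; lia.
  rewrite [(_ - b.+1)%N](_ : _ = q); last by lia.
  rewrite [(_ - b)%N](_ : _ = q.+1); last by lia.
  rewrite (_ : (N + q.+1).-1 = (N + q).-1.+1); last by lia.
  rewrite !factS_rat prednK; last by lia.
  rewrite exprS -!natr1 !natrD; field.
  by rewrite fact_neq0 natr1 pnatr_eq0.
- by rewrite !mulr0 !addr0.
by rewrite subrr mul0r !mulr0 !addr0.
Qed.

(** Every term of [opX_prod] reduces to a multiple of the same X, so only the sum of the scalars
    matters. Since k <= a, no exponent of x_1 is truncated; since k >= 3, the variable created has
    index at least 2, as the reduction requires. *)
Lemma opX_lowD g k (I : finType) (U : {set I}) (nu : I -> nat) a :
    (3 <= k)%N -> (k <= a)%N -> U != set0 -> (forall i, i \in U -> (1 < nu i)%N) ->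
    (a + \sum_(i in U) nu i)%N = g ->
  lowD g (opX 0 k (dp a * \prod_(i in U) var A (nu i))).
Proof.
move=> k3 ka /set0Pn[i0 i0U] nuU eg; set N := (\sum_(i in U) nu i)%N in eg *.
have nuU0 i : i \in U -> (0 < nu i)%N by move/nuU/ltnW.
rewrite (opX_prod 0 k a nuU0).
pose G j : rat := if (j <= k)%N then (-1) ^+ j * ((N + (k - j)).-1)`!%:R / (k - j)`!%:R else 0.
pose X := dp (a - k + #|U|)%N * var A (N + k.-1 - #|U|).
pose c (B : {set I}) : rat := (-1) ^+ #|U| / \prod_(i in U) (nu i)`!%:R *
  ((\sum_(i in B) nu i)%:R * G #|B| + (k%:R - #|B|%:R) * G #|B|).
have N0 : (0 < N)%N by rewrite /N (bigD1 i0) //= addn_gt0 nuU0.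
have sum_c : \sum_(B : {set I} | B \subset U) c B = 0.
  (* The weighted sum becomes a sum over subsets avoiding i0; splitting the other sum by whether i0
     lies in B, each such subset contributes one instance of [falling_step]. *)
  rewrite /c -mulr_sumr big_split /= (sum_subset_weight _ _ i0U) -/N.
  rewrite -(setD1K i0U) big_subset_setU1 ?setD11 // setD1K // -big_split mulr_sumr -big_split /=.
  rewrite [X in _ * X]big1 ?mulr0 // => B sB; rewrite cardsU1 (_ : i0 \notin B) ?add1n.
    by rewrite addrA; apply: falling_step.
  by apply/negP => /(subsetP sB); rewrite setD11.
have sum_cX : \sum_(B : {set I} | B \subset U) c B *: X = 0.
  by rewrite -scaler_suml sum_c scale0r.
rewrite -[Y in lowD g Y]subr0 -[in - 0]sum_cX -sumrB.
apply: lowD_sum => B sB; rewrite /opX_coef /c /G.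
case: leqP => Bk; last first.
  by rewrite !mul0r !mulr0 ?addr0 ?mulr0 !scale0r subr0; apply: lowD0.
have nB := sum_ge_card nuU sB; have nU := sum_ge_card nuU (subxx U).
have BU := subset_leq_card sB.
have NB : N = (\sum_(i in B) nu i + \sum_(i in U :\: B) nu i)%N by apply: sum_nat_setD.
have cUB : #|U :\: B| = (#|U| - #|B|)%N by rewrite cardsD (setIidPr sB).
have nuUB i : i \in U :\: B -> (1 < nu i)%N by rewrite inE => /andP[_ /nuU].
rewrite add0n -mulrDl.
have -> : (\sum_(i in B) nu i)%:R + (k%:R - #|B|%:R) = (\sum_(i in B) nu i + (k - #|B|))%N%:R :> rat.
  by rewrite natrD natrB.
set cB := (\sum_(i in B) nu i + (k - #|B|))%N.
have c1 : (1 < cB.-1)%N by rewrite /cB; lia.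
have wt : (a - k + #|B| + (cB.-1 + \sum_(i in U :\: B) nu i)).+1 = g by rewrite /cB; lia.
have := lowDZ (cB`!%:R / (k - #|B|)`!%:R / \prod_(i in B) (nu i)`!%:R)
  (reduces_cons (@reduces_all _) cUB c1 nuUB wt).
have -> : (cB.-1 + \sum_(i in U :\: B) nu i = (N + (k - #|B|)).-1)%N by rewrite /cB; lia.
have -> : ((N + (k - #|B|)).-1 - (#|U| - #|B|) = N + k.-1 - #|U|)%N by lia.
have -> : (a - k + #|B| + (#|U| - #|B|) = a - k + #|U|)%N by lia.
have -> : a%:Z - (k%:Z - #|B|%:Z) = (a - k + #|B|)%N%:Z by lia.
rewrite -/X scalerBr scalerA (mulrCA (dp _)) mulrA (_ : 0`!%:R = 1 :> rat) // mul1r.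
suff -> : cB`!%:R / (k - #|B|)`!%:R / \prod_(i in B) (nu i)`!%:R *
     ((-1) ^+ (#|U| - #|B|) * (((N + (k - #|B|)).-1)`!%:R /
       ((cB.-1)`!%:R * \prod_(i in U :\: B) (nu i)`!%:R))) =
   (-1) ^+ #|U| / \prod_(i in U) (nu i)`!%:R *
     (cB%:R * ((-1) ^+ #|B| * ((N + (k - #|B|)).-1)`!%:R / (k - #|B|)`!%:R)) :> rat by [].
have s2 : (-1) ^+ #|B| * (-1) ^+ #|B| = 1 :> rat by rewrite -expr2 sqrr_sign.
rewrite -[LHS]mul1r -[X in X * _ = _]s2 [in RHS](esym (subnK BU)) exprD (prod_setD _ sB).
have cB0 : (0 < cB)%N by lia.
rewrite -[X in X`!%:R / _ / _](prednK cB0) factS_rat (prednK cB0).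
by field; rewrite !fact_neq0 !prod_fact_neq0.
Qed.

End NormalForm.

(** * Small exponents of x_1, and degrees above g *)

Section Shift.
Context {A : derivAlg}.
Implicit Types (f h : A) (g k n : nat) (z : int).
Local Notation dp := (divpow (var A 1)).

Lemma der1_lowmon g f : lowmon g.+1 f -> spanned (lowmon g) (der A 1 f).
Proof.
move=> [I [U [nu [[|a] [U0 nuU eg ->]]]]].
  by rewrite der1_divpow der1_prod // mulr0 addr0 mul0r; apply: spanned0.
rewrite der1_divpow der1_prod // mulr0 addr0 (_ : a.+1%:Z - 1 = a%:Z); last by lia.
by apply: spanned_gen; exists I, U, nu, a; split => //; move: eg; rewrite addSn => -[].
Qed.

(** Each d_1 passes through D by [der1_opD], lowering g by one, and keeps the span of admissible
    monomials by [der1_lowmon]. *)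
Lemma iter_der1_lowD L g f : lowD (L + g) f -> lowD g (iter L (der A 1) f).
Proof.
elim: L f => [|L IHL] f // [w lw ->]; rewrite iterSr; apply: IHL.
rewrite addSn der1_opD; exists (der A 1 w) => //.
by apply: spanned_map lw => h; apply: der1_lowmon.
Qed.

Lemma iter_der1_opX L k f : (3 <= k)%N ->
  iter L (der A 1) (opX 0 k f) = opX 0 k (iter L (der A 1) f).
Proof. by move=> k3; elim: L => //= L ->; rewrite der1_opX. Qed.

Lemma iter_der1_mon L (I : finType) (nu : I -> nat) (U : {set I}) a :
    (forall i, i \in U -> 1 < nu i)%N ->
  iter L (der A 1) (dp (L + a)%N * \prod_(i in U) var A (nu i)) =
    dp a * \prod_(i in U) var A (nu i).
Proof.
move=> nuU; elim: L => // L IHL.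
rewrite iterSr der1_divpow der1_prod // mulr0 addr0.
by rewrite (_ : (L.+1 + a)%N%:Z - 1 = (L + a)%N%:Z) //; lia.
Qed.

(* Truncation at [x_1^0] only spoils the reduction when the exponent of x_1 is *)
(* small; raising it by k and applying (d/dx_1)^k turns D_(g+k) into D_g.      *)
Lemma opX_lowmon g k f : (3 <= k)%N -> lowmon g f -> lowD g (opX 0 k f).
Proof.
move=> k3 [I [U [nu [a [U0 nuU eg ->]]]]].
rewrite -(iter_der1_mon k a nuU) -iter_der1_opX //; apply: iter_der1_lowD.
by apply: opX_lowD; rewrite ?leq_addr // -addnA eg.
Qed.

(** D_k lowers the degree by one and always creates a variable of index at least 2. This handles
    degree g+1, where the image falls to degree g and must avoid x_1^g; U may be empty. *)
Lemma opX_mon_spanned k (I : finType) (nu : I -> nat) (U : {set I}) a :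
    (3 <= k)%N -> (forall i, i \in U -> 1 < nu i)%N ->
  spanned (lowmon (a + \sum_(i in U) nu i).-1)
    (opX 0 k (dp a * \prod_(i in U) var A (nu i))).
Proof.
move=> k3 nuU; have nuU0 i : i \in U -> (0 < nu i)%N by move/nuU/ltnW.
rewrite opX_prod //; apply: spanned_sum => B sB.
rewrite /opX_coef; case: leqP => Bk; last by rewrite mul0r scale0r; apply: spanned0.
apply: spannedZ; have nB := sum_ge_card nuU sB; have NB := sum_nat_setD nu sB.
pose c := (0 + \sum_(i in B) nu i + (k - #|B|)).-1; rewrite -/c.
case: (leqP k (a + #|B|)) => [kaB|aBk]; last first.
  rewrite (_ : a%:Z - _ = Negz (k - #|B| - a).-1); last by lia.
  by rewrite /= mulr0 mul0r; apply: spanned0.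
rewrite [var A _ * _]mulrC -mulrA.
apply: spanned_gen; pose nu' (o : option I) := if o is Some i then nu i else c.
exists (option I), (None |: [set Some i | i in U :\: B]), nu', (a + #|B| - k)%N; split.
- by apply/set0Pn; exists None; rewrite setU11.
- move=> [i|]; rewrite !inE /=; last by rewrite /c; lia.
  by move=> /imsetP[j + [->]]; rewrite inE => /andP[_ /nuU].
- by rewrite big_optionU1 /= NB /c; lia.
by rewrite big_optionU1 /= (_ : a%:Z - _ = (a + #|B| - k)%N%:Z) //; lia.
Qed.
End Shift.

(** * Rothe-Hurwitz identities *)

Section FallingFactorial.

Definition ff (v : rat) (s : nat) : rat := \prod_(i < s) (v - i%:R).

Lemma ff0 v : ff v 0 = 1.
Proof. by rewrite /ff big_ord0. Qed.

Lemma ffSr v s : ff v s.+1 = ff v s * (v - s%:R).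
Proof. by rewrite /ff big_ord_recr. Qed.

Lemma ffSl v s : ff v s.+1 = v * ff (v - 1) s.
Proof.
rewrite /ff big_ord_recl subr0; congr (_ * _); apply: eq_bigr => i _ /=.
by rewrite -nat1r opprD addrA.
Qed.

Lemma ffD v s t : ff v (s + t) = ff v s * ff (v - s%:R) t.
Proof.
elim: t => [|t IHt]; first by rewrite addn0 ff0 mulr1.
by rewrite addnS !ffSr IHt natrD -mulrA opprD addrA.
Qed.

Lemma ff_diff v s : ff (v + 1) s.+1 - ff v s.+1 = s.+1%:R * ff v s.
Proof. by rewrite ffSl ffSr addrK -natr1; ring. Qed.

Lemma ffN c s : ff (- c) s = (-1) ^+ s * ff (c + s%:R - 1) s.
Proof.
elim: s => [|s IHs]; first by rewrite !ff0 mulr1.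
rewrite ffSr IHs exprS [ff _ s.+1]ffSl -natr1.
rewrite (_ : c + (s%:R + 1) - 1 - 1 = c + s%:R - 1); last by ring.
by rewrite (_ : c + (s%:R + 1) - 1 = c + s%:R); ring.
Qed.

Lemma ff_natS s : ff 0 s.+1 = 0.
Proof. by rewrite ffSl mul0r. Qed.

Lemma ff_fact n s : (s <= n)%N -> ff n%:R s = n`!%:R / (n - s)`!%:R.
Proof.
elim: s => [|s IHs] sn; first by rewrite ff0 subn0 divff ?fact_neq0.
rewrite ffSr IHs 1?ltnW // -natrB 1?ltnW // -[in (n - s)`!](subnSK sn) factS_rat subnSK //.
by field; rewrite fact_neq0 pnatr_eq0 subn_eq0 -ltnNge.
Qed.

Lemma ff_small n s : (n < s)%N -> ff n%:R s = 0.
Proof.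
move=> ns; rewrite /ff (bigD1 (Ordinal ns)) //= subrr mul0r //.
Qed.

(** An iterated finite difference of order #|B|, with steps h i, kills a polynomial of degree r <
    #|B|. *)
Lemma ff_alternating_sum (I : finType) (B : {set I}) (h : I -> nat) (z : rat) r :
  (r < #|B|)%N ->
  \sum_(C : {set I} | C \subset B) (-1) ^+ #|C| * ff (z + (\sum_(i in C) h i)%:R) r = 0.
Proof.
elim/finset_ind: B r z => [|B i iB IHB] r z; first by rewrite cards0.
rewrite cardsU1 iB add1n ltnS => rB; rewrite big_subset_setU1 // -big_split /=.
have {IHB} IH j z' : ((j < r)%N) -> \sum_(C : {set I} | C \subset B)
    (-1) ^+ #|C| * ff (z' + (\sum_(i in C) h i)%:R) j = 0.
  by move=> jr; apply: IHB; apply: leq_trans rB.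
transitivity (- \sum_(C : {set I} | C \subset B) (-1) ^+ #|C| *
   (ff (z + (h i)%:R + (\sum_(i in C) h i)%:R) r - ff (z + (\sum_(i in C) h i)%:R) r)).
  rewrite -sumrN; apply: eq_bigr => C sC.
  have iC : i \notin C by apply: contra iB; apply: (subsetP sC).
  by rewrite cardsU1 iC add1n exprS big_setU1 //= natrD addrA; ring.
(* A step of length h i is a succession of unit steps, and each unit difference lowers the degree by
   one ([ff_diff]). *)
apply/eqP; rewrite oppr_eq0; apply/eqP; elim: (h i) => [|l IHl].
  by rewrite big1 // => C _; rewrite addr0 subrr mulr0.
case: r {rB} IH IHl => [|r] IH IHl.
  by rewrite big1 // => C _; rewrite !ff0 subrr mulr0.
transitivity (\sum_(C : {set I} | C \subset B) (-1) ^+ #|C| *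
     (ff (z + l%:R + (\sum_(i in C) h i)%:R) r.+1 - ff (z + (\sum_(i in C) h i)%:R) r.+1)
   + r.+1%:R * \sum_(C : {set I} | C \subset B)
     (-1) ^+ #|C| * ff (z + l%:R + (\sum_(i in C) h i)%:R) r); last first.
  by rewrite IHl IH // mulr0 addr0.
rewrite mulr_sumr -big_split /=; apply: eq_bigr => C _.
rewrite mulrCA -ff_diff -natr1.
rewrite (_ : z + (l%:R + 1) + _ = z + l%:R + (\sum_(i in C) h i)%:R + 1); first by ring.
by ring.
Qed.

End FallingFactorial.

(** * Rothe polynomials and their convolution *)

Section Hurwitz.
Context (I : finType) (nu : I -> nat).
Implicit Types (B C : {set I}).
Local Notation nuS B := (\sum_(i in B) nu i)%N.

(** With N the sum of nu over B and n = #|B|, this is n! times the Rothe coefficient y/(y+N)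
    binom(y+N, n), written without the division. *)
Definition rothe (y : rat) B : rat :=
  if #|B| is s.+1 then y * ff (y + (nuS B)%:R - 1) s else 1.

Hypothesis nu_gt0 : forall i, (0 < nu i)%N.

(* At this value of the free parameter both falling factorials merge into one, *)
(* and the sum becomes an iterated finite difference.                          *)
Lemma hurwitz0 (v : rat) B :
  \sum_(C : {set I} | C \subset B) ff (- v - (nuS (B :\: C))%:R) #|C| * rothe v (B :\: C)
    = (#|B| == 0%N)%:R.
Proof.
have [B0|] := posnP #|B|.
  move/eqP: B0; rewrite cards_eq0 => /eqP ->.
  rewrite (big_pred1 set0) => [|C]; last by rewrite subset0.
  by rewrite /rothe set0D cards0 ff0 mul1r.
case eB: #|B| => [|s] // _.
(* After the reflection [ffN], the adjoining falling factorials combine to one whose argument moves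
   with nuS C - #|C|; this is the sum of h over C because every nu i is positive. *)
pose h i := (nu i).-1.
rewrite (reindex_onto (fun C => B :\: C) (fun C => B :\: C)) /=; last first.
  by move=> C sC; rewrite setDDr setDv set0U; apply/setIidPr.
transitivity ((-1) ^+ s.+1 * v * \sum_(C : {set I} | C \subset B)
   (-1) ^+ #|C| * ff (v + s%:R + (\sum_(i in C) h i)%:R) s).
  rewrite mulr_sumr; apply: eq_big => C.
    by rewrite subsetDl /= setDDr setDv set0U; apply/eqP/idP => [<-|/setIidPr]; rewrite ?subsetIl.
  rewrite setDDr setDv set0U => /andP[_ /eqP CB].
  have sC : C \subset B by rewrite -CB subsetIl.
  rewrite CB cardsD (setIidPr sC) eB.
  have nuC : (nuS C)%:R = #|C|%:R + (\sum_(i in C) h i)%:R :> rat.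
    rewrite -natrD -sum1_card -big_split /=; congr _%:R; apply: eq_bigr => i _.
    by rewrite add1n prednK.
  have /subset_leq_card := sC; rewrite eB => cC.
  rewrite -opprD ffN /rothe nuC.
  case eC: #|C| cC => [|c] cC.
    have -> : C = set0 by apply/eqP; rewrite -cards_eq0 eC.
    rewrite big_set0 subn0 addr0 expr0 mul1r mulr1 ffSr -natr1.
    have -> : v + (s%:R + 1) - 1 = v + s%:R by ring.
    by rewrite addr0 addrK; ring.
  move: (subnK cC); rewrite subSS addnS => -[<-]; set t := (s - c)%N; set H := (\sum_(i in C) _)%:R.
  have s2 : (-1) ^+ c * (-1) ^+ c = 1 :> rat by rewrite -expr2 sqrr_sign.
  rewrite addnK ffD !exprS !exprD natrD -natr1.
  rewrite (_ : v + (t%:R + c%:R) + H - t%:R = v + (c%:R + 1 + H) - 1); last by ring.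
  rewrite (_ : v + (c%:R + 1 + H) + t%:R - 1 = v + (t%:R + c%:R) + H); last by ring.
  rewrite [in LHS](_ : (-1) ^+ t = (-1) ^+ t * ((-1) ^+ c * (-1) ^+ c)); last by rewrite s2 mulr1.
  by ring.
by rewrite ff_alternating_sum ?eB // mulr0.
Qed.

(** Both sides have the same unit difference in j, by induction on #|B|, and they agree at j = 0 by
    [hurwitz0]. *)
Lemma hurwitz (v : rat) B j :
  \sum_(C : {set I} | C \subset B) ff (j%:R - v - (nuS (B :\: C))%:R) #|C| * rothe v (B :\: C)
    = ff j%:R #|B|.
Proof.
have [n] := ubnP #|B|; elim: n B j => // n IHn B j ltBn.
elim: j => [|j IHj].
  by rewrite -[0%:R]/(0 : rat) sub0r hurwitz0; case: #|B| => [|s]; rewrite ?ff0 ?ff_natS.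
case eB: #|B| IHj ltBn => [|s] IHj ltBn.
  move/eqP: eB IHj; rewrite cards_eq0 => /eqP ->.
  by rewrite !(big_pred1 set0) ?cards0 ?ff0 // => C; rewrite subset0.
(* The difference in j of the falling factorial of order #|C| gives a factor #|C|, spread here as a
   sum over i in C; each summand is a term of the identity for B without i. *)
have term C : C \subset B ->
    ff (j.+1%:R - v - (nuS (B :\: C))%:R) #|C| * rothe v (B :\: C)
      - ff (j%:R - v - (nuS (B :\: C))%:R) #|C| * rothe v (B :\: C)
    = \sum_(i in C) ff (j%:R - v - (nuS ((B :\ i) :\: (C :\ i)))%:R) #|C :\ i|
        * rothe v ((B :\ i) :\: (C :\ i)).
  move=> sC; rewrite -mulrBl.
  transitivity (\sum_(i in C) ff (j%:R - v - (nuS (B :\: C))%:R) #|C|.-1 * rothe v (B :\: C)).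
    rewrite -mulr_suml sumr_const; congr (_ * _); case: #|C| => [|c].
      by rewrite !ff0 subrr mulr0n.
    rewrite -[RHS]mulr_natl -[c.+1.-1]/c -ff_diff; congr (ff _ _ - _); rewrite -natr1; ring.
  apply: eq_bigr => i iC.
  have -> : (B :\ i) :\: (C :\ i) = B :\: C.
    by apply/setP => l; rewrite !inE; case: eqP => [->|]; rewrite ?iC.
  by rewrite (cardsD1 i C) iC.
have sum_diff : \sum_(C : {set I} | C \subset B)
     ff (j.+1%:R - v - (nuS (B :\: C))%:R) #|C| * rothe v (B :\: C) - ff j%:R s.+1
   = s.+1%:R * ff j%:R s.
  rewrite -IHj -sumrB (eq_bigr _ term).
  rewrite (exchange_big_dep (fun i => i \in B)) /=; last by move=> C i /subsetP; apply.
  transitivity (\sum_(i in B) ff j%:R s); last by rewrite sumr_const eB mulr_natl.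
  apply: eq_bigr => i iB.
  have cBi : #|B :\ i| = s by move: eB; rewrite (cardsD1 i) iB => -[].
  rewrite -[in RHS]cBi -[RHS](IHn (B :\ i) j); last by rewrite cBi.
  rewrite (reindex_onto (fun C => i |: C) (fun C => C :\ i)) /=; last first.
    by move=> C /andP[_ iC]; rewrite setD1K.
  apply: eq_big => C; last by move=> /andP[_ /eqP ->].
  rewrite setU11 andbT subUset sub1set iB subsetD1 /=; congr (_ && _).
  apply/eqP/idP => [<-|iC]; first by rewrite setD11.
  by rewrite setU1K.
by rewrite -[LHS](subrK (ff j%:R s.+1)) sum_diff -ff_diff subrK natr1.
Qed.

(** This is [hurwitz] at j = u + v + nuS B, where the argument of the falling factorial becomes u +
    nuS C. *)
Lemma rothe_convolution (u v : nat) B :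
  \sum_(C : {set I} | C \subset B) ff (u + nuS C)%N%:R #|C| * rothe v%:R (B :\: C)
    = ff (u + v + nuS B)%N%:R #|B|.
Proof.
rewrite -(hurwitz v%:R); apply: eq_bigr => C sC; congr (ff _ _ * _).
rewrite [in RHS](big_setID C) /= (setIidPr sC) !natrD; ring.
Qed.

End Hurwitz.

(** * Sums over set partitions *)

Section PartitionSums.
Context (I : finType) (V : nmodType).
Implicit Types (U B C J : {set I}) (P Q : {set {set I}}).

Lemma partition_cover P Q U : partition Q U -> P \subset Q -> partition P (cover P).
Proof.
case/and3P=> _ tQ Q0 sPQ; rewrite /partition eqxx (trivIsetS sPQ tQ) /=.
by apply: contra Q0; apply: (subsetP sPQ).
Qed.

Lemma partition_disjoint P Q U B :
  partition P B -> partition Q U -> [disjoint B & U] -> [disjoint P & Q].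
Proof.
move=> pP pQ dBU; apply/pred0P => J /=; apply/negP => /andP[JP JQ].
have /set0Pn[i iJ] := partition_neq0 pP JP.
have iB := subsetP (partitionS pP JP) _ iJ.
by have := disjointFr dBU iB; rewrite (subsetP (partitionS pQ JQ) _ iJ).
Qed.

Lemma partition_setU P Q U B :
  partition P B -> partition Q U -> [disjoint B & U] -> partition (P :|: Q) (B :|: U).
Proof.
move=> pP pQ dBU; case/and3P: (pP) => /eqP cP tP P0; case/and3P: (pQ) => /eqP cQ tQ Q0.
rewrite /partition inE negb_or P0 Q0 trivIsetU // ?cP ?cQ // !andbT.
by rewrite /cover bigcup_setU -!/(cover _) cP cQ.
Qed.

Lemma partition_setD P Q U : partition Q U -> P \subset Q -> partition (Q :\: P) (U :\: cover P).
Proof.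
move=> pQ sPQ; case/and3P: (pQ) => /eqP cQ tQ Q0.
rewrite /partition trivIsetD // inE (negbTE Q0) andbF !andbT.
apply/eqP/setP => i; rewrite inE -cQ; apply/bigcupP/andP => [[J]|[iP /bigcupP[J JQ iJ]]].
  rewrite inE => /andP[JP JQ] iJ; split; last by apply/bigcupP; exists J.
  apply/bigcupP => -[K KP iK]; move: JP.
  by rewrite -(def_pblock tQ JQ iJ) (def_pblock tQ (subsetP sPQ _ KP) iK) KP.
exists J => //; rewrite inE JQ andbT; apply: contra iP => JP.
by apply/bigcupP; exists J.
Qed.

Lemma setU_setDK P Q : [disjoint P & Q] -> (P :|: Q) :\: P = Q.
Proof.
move=> dPQ; rewrite setDUl setDv set0U; apply/setDidPl.
by rewrite disjoint_sym.
Qed.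

(** Choosing some blocks P of a partition of U amounts to choosing their union B and then
    partitioning B and its complement separately. *)
Lemma sum_partition_split U (F : {set {set I}} -> {set {set I}} -> V) :
  \sum_(Q | partition Q U) \sum_(P : {set {set I}} | P \subset Q) F P (Q :\: P)
  = \sum_(B : {set I} | B \subset U) \sum_(P | partition P B) \sum_(Q | partition Q (U :\: B)) F P Q.
Proof.
rewrite (exchange_big_dep (fun P => partition P (cover P) && (cover P \subset U))) /=; last first.
  move=> Q P pQ sPQ; rewrite (partition_cover pQ sPQ) /=.
  rewrite -(cover_partition pQ); apply/bigcupsP => J JP; apply: bigcup_sup.
  exact: (subsetP sPQ).
rewrite (partition_big (@cover I) (fun B => B \subset U)) /=; last by move=> P /andP[].
apply: eq_bigr => B sB; apply: eq_big => [P|P].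
  apply/andP/idP => [[/andP[pP _] /eqP <-] //|pP].
  by rewrite (cover_partition pP) pP sB eqxx.
move=> /andP[/andP[pP _] /eqP cP]; rewrite cP in pP.
have dB : [disjoint B & U :\: B] by rewrite -setI_eq0 setIDA setIC -setIDA setDv setI0.
have BUD : B :|: (U :\: B) = U by rewrite setDE setUIr setUCr setIT; apply/setUidPr.
rewrite (reindex_onto (fun Q => P :|: Q) (fun Q => Q :\: P)) /=; last first.
  by move=> Q /andP[_ sPQ]; rewrite setDE setUIr setUCr setIT; apply/setUidPr.
apply: eq_big => [Q|Q].
  rewrite subsetUl andbT; apply/andP/idP => [[pPQ /eqP e]|pQ].
    by rewrite -e -cP; apply: partition_setD => //; apply: subsetUl.
  split; last by rewrite setU_setDK //; apply: partition_disjoint pP pQ dB.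
  by rewrite -BUD; apply: partition_setU.
by move=> /andP[_ /eqP ->].
Qed.

(** The partitions are sorted by the block containing i, which is i together with B. *)
Lemma sum_partition_setU1 U i (F : {set {set I}} -> V) : i \notin U ->
  \sum_(Q | partition Q (i |: U)) F Q
  = \sum_(B : {set I} | B \subset U) \sum_(Q | partition Q (U :\: B)) F ((i |: B) |: Q).
Proof.
move=> iU.
rewrite (partition_big (fun Q => pblock Q i :\ i) (fun B => B \subset U)) /=; last first.
  move=> Q pQ; have iQ : i \in cover Q by rewrite (cover_partition pQ) setU11.
  rewrite subDset; exact: (partitionS pQ (pblock_mem iQ)).
apply: eq_bigr => B sB.
have iB : i \notin B by apply: contra iU; apply: (subsetP sB).
have dB : [disjoint i |: B & U :\: B].
  rewrite -setI_eq0; apply/eqP/setP => j; rewrite !inE.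
  by case: eqP => [->|] /=; rewrite ?(negbTE iU) ?andbF //; case: (j \in B).
have UB : (i |: B) :|: (U :\: B) = i |: U.
  by rewrite -setUA; congr (_ :|: _); rewrite setDE setUIr setUCr setIT; apply/setUidPr.
have B0 : i |: B != set0 by apply/set0Pn; exists i; rewrite setU11.
rewrite (reindex_onto (fun Q => (i |: B) |: Q) (fun Q => Q :\ (i |: B))) /=; last first.
  move=> Q /andP[pQ /eqP e]; have iQ : i \in cover Q by rewrite (cover_partition pQ) setU11.
  by rewrite setD1K // -e setD1K ?pblock_mem // mem_pblock.
apply: eq_bigl => Q.
apply/andP/idP => [[/andP[pQ _] /eqP e]|pQ].
  rewrite -e (_ : U :\: B = (i |: U) :\: (i |: B)).
    by apply: partitionD1 => //; apply: setU11.
  by apply/setP => j; rewrite !inE; case: eqP => [->|] //=; rewrite (negbTE iU) andbF.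
have pBQ : partition ((i |: B) |: Q) (i |: U) by rewrite -UB; apply: partitionU1.
have BQ : i |: B \notin Q.
  apply/negP => /(partitionS pQ) /subsetP /(_ i); rewrite setU11 => /(_ isT).
  by rewrite inE (negbTE iU) andbF.
split; last by rewrite setU1K.
by rewrite pBQ (def_pblock (partition_trivIset pBQ) (setU11 _ _) (setU11 _ _)) setU1K // eqxx.
Qed.

End PartitionSums.

(** Isolate the block of an element i and use ff(y, q+1) = y ff(y-1, q): by induction the other
    blocks give a Rothe polynomial at y - 1, and [rothe_convolution] with u = nu i sums over the
    block. *)
Lemma sum_partition_rothe (I : finType) (nu : I -> nat) (B : {set I}) (y : nat) :
    (forall i, 0 < nu i)%N ->
  \sum_(Q : {set {set I}} | partition Q B)
    ff y%:R #|Q| * \prod_(J in Q) ff (\sum_(i in J) nu i)%N%:R #|J|.-1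
  = rothe nu y%:R B.
Proof.
move=> nu0; have [n] := ubnP #|B|; elim: n B y => // n IHn B y ltBn.
have [->|[i iB]] := set_0Vmem B.
  rewrite (big_pred1 set0) => [|Q]; last by rewrite partition_set0.
  by rewrite /rothe !cards0 ff0 big_set0 mulr1.
rewrite -(setD1K iB) sum_partition_setU1 ?setD11 //; set U := B :\ i.
have iU : i \notin U by rewrite setD11.
have ltUn : (#|U| < n)%N by move: ltBn; rewrite (cardsD1 i) iB.
rewrite /rothe cardsU1 iU add1n.
transitivity (y%:R * \sum_(C : {set I} | C \subset U)
    ff (nu i + \sum_(j in C) nu j)%N%:R #|C| * rothe nu (y%:R - 1) (U :\: C)).
  rewrite mulr_sumr; apply: eq_bigr => C sC.
  have iC : i \notin C by apply: contra iU; apply: (subsetP sC).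
  transitivity (\sum_(Q | partition Q (U :\: C)) y%:R * (ff (nu i + \sum_(j in C) nu j)%N%:R #|C| *
     (ff (y%:R - 1) #|Q| * \prod_(J in Q) ff (\sum_(i in J) nu i)%N%:R #|J|.-1))).
    apply: eq_bigr => Q pQ.
    have CQ : i |: C \notin Q.
      apply/negP => /(partitionS pQ) /subsetP /(_ i); rewrite setU11 => /(_ isT).
      by rewrite inE (negbTE iU) andbF.
    rewrite cardsU1 CQ add1n ffSl big_setU1 //= big_setU1 //= cardsU1 iC add1n /=; ring.
  rewrite -!mulr_sumr; case: y => [|y]; first by rewrite !mul0r.
  rewrite -natr1 addrK IHn //.
  by apply: leq_ltn_trans ltUn; apply/subset_leq_card/subsetDl.
case: y => [|y]; first by rewrite !mul0r.
rewrite -natr1 addrK rothe_convolution // big_setU1 //=; congr (_ * ff _ _).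
rewrite !natrD; ring.
Qed.

(** * The formula for S *)

Section FourierFormula.
Context {A : derivAlg} (I : finType) (nu : I -> nat).
Hypothesis nu_gt0 : forall i, (0 < nu i)%N.
Implicit Types (U B C J : {set I}) (P Q : {set {set I}}) (e z : int).
Local Notation dp := (divpow (var A 1)).
Local Notation nuS B := (\sum_(i in B) nu i)%N.

Definition bcoef_set J : rat := (nuS J)`!%:R / \prod_(i in J) (nu i)`!%:R.

Definition dindex_set J : nat := ((nuS J).+1 - #|J|)%N.

(** The right-hand side of the formula for S, lifted to polynomials, with e in place of g - n and
    any finite index set so that an index can be added. *)
Definition Sform e U : A :=
  \sum_(Q : {set {set I}} | partition Q U)
    (\prod_(J in Q) bcoef_set J) *:
      (dp (e - #|Q|%:Z - (nuS U)%:Z) * \prod_(J in Q) var A (dindex_set J)).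

Lemma nuS_ge_card B : (#|B| <= nuS B)%N.
Proof. by rewrite -sum1_card; apply: leq_sum => i _. Qed.

Lemma sum_dindex P B : partition P B -> (\sum_(J in P) dindex_set J + #|B| = nuS B + #|P|)%N.
Proof.
move=> pP; rewrite (card_partition pP) (set_partition_big _ pP) -sum1_card -!big_split /=.
apply: eq_bigr => J _; rewrite /dindex_set addn1 subnK //.
by apply: leq_trans (nuS_ge_card J) (leqnSn _).
Qed.

Lemma bcoef_set_dindex J : J != set0 ->
  bcoef_set J / (dindex_set J)`!%:R = ff (nuS J)%:R #|J|.-1 / \prod_(i in J) (nu i)`!%:R.
Proof.
rewrite -card_gt0 => J0; have nJ := nuS_ge_card J.
rewrite /bcoef_set /dindex_set ff_fact; last by apply: leq_trans nJ; apply: leq_pred.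
rewrite (_ : _.+1 - _ = nuS J - #|J|.-1)%N; last by lia.
by field; rewrite fact_neq0 prod_fact_neq0.
Qed.

(** The blocks P tile B and are merged with an index of value k. By [sum_dindex] the numerator of
    [opX_coef] is M! for every P with at most k+1 blocks, and the rest is [sum_partition_rothe] at y
    = k + 1. *)
Lemma sum_partition_bcoef k B :
  \sum_(P | partition P B) (\prod_(J in P) bcoef_set J) *
     (opX_coef 0 k.+1 (\sum_(J in P) dindex_set J) #|P| / \prod_(J in P) (dindex_set J)`!%:R)
  = (k + nuS B)`!%:R / (k`!%:R * \prod_(i in B) (nu i)`!%:R).
Proof.
have nB := nuS_ge_card B; pose M := (nuS B - #|B| + k.+1)%N.
transitivity (M`!%:R / (k.+1`!%:R * \prod_(i in B) (nu i)`!%:R) * rothe nu k.+1%:R B).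
  rewrite -sum_partition_rothe // mulr_sumr; apply: eq_bigr => P pP.
  have -> : \prod_(i in B) (nu i)`!%:R = \prod_(J in P) \prod_(i in J) (nu i)`!%:R :> rat.
    exact: set_partition_big.
  rewrite mulrCA -prodf_div (eq_bigr (fun J =>
    ff (nuS J)%:R #|J|.-1 / \prod_(i in J) (nu i)`!%:R)); last first.
    by move=> J JP; apply: bcoef_set_dindex; apply: partition_neq0 pP JP.
  rewrite prodf_div /opX_coef add0n; have sP := sum_dindex pP.
  case: leqP => Pk; last by rewrite ff_small // mul0r mul0r mulr0.
  rewrite ff_fact // (_ : (_ + (_ - _))%N = M); last by rewrite /M; lia.
  have nz : \prod_(J in P) \prod_(i in J) (nu i)`!%:R != 0 :> rat.
    by apply/prodf_neq0 => J _; apply: prod_fact_neq0.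
  by rewrite (_ : 0`!%:R = 1 :> rat) //; field; rewrite nz !fact_neq0.
rewrite /rothe; case eB: #|B| => [|s].
  move/eqP: eB; rewrite cards_eq0 => /eqP eB; rewrite /M eB !big_set0 cards0 add0n addn0.
  by field; rewrite !fact_neq0.
rewrite -addrA [_ - 1]addrC addrA -natr1 addrK -natrD ff_fact; last by lia.
rewrite (_ : M = k + nuS B - s)%N; last by rewrite /M; lia.
rewrite factS_rat -natr1; field.
by rewrite !fact_neq0 prod_fact_neq0 natr1 pnatr_eq0.
Qed.

(** P collects the blocks hit by derivatives and Q the others; the blocks of P fuse with i into the
    single block i |: B, where B is their union. *)
Lemma opX_Sform e U i : i \notin U ->
  opX 0 (nu i).+1 (Sform e U) = Sform e (i |: U).
Proof.
move=> iU; set k := nu i.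
pose F P Q : A := ((\prod_(J in P) bcoef_set J * \prod_(J in Q) bcoef_set J) *
   (opX_coef 0 k.+1 (\sum_(J in P) dindex_set J) #|P| / \prod_(J in P) (dindex_set J)`!%:R)) *:
  (var A (0 + \sum_(J in P) dindex_set J + (k.+1 - #|P|)).-1
    * dp (e - (#|P| + #|Q|)%N%:Z - (nuS U)%:Z - (k.+1%:Z - #|P|%:Z))
    * \prod_(J in Q) var A (dindex_set J)).
transitivity (\sum_(Q | partition Q U) \sum_(P : {set {set I}} | P \subset Q) F P (Q :\: P)).
  rewrite linear_sum; apply: eq_bigr => Q pQ /=; rewrite opXZ opX_prod; last first.
    by move=> J _; rewrite subn_gt0 ltnS nuS_ge_card.
  rewrite scaler_sumr; apply: eq_bigr => P sPQ; rewrite scalerA /F -prod_setD //.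
  by rewrite cardsD (setIidPr sPQ) subnKC // subset_leq_card.
rewrite sum_partition_split /Sform sum_partition_setU1 //; apply: eq_bigr => B sB.
rewrite exchange_big /=; apply: eq_bigr => Q pQ.
have iB : i \notin B by apply: contra iU; apply: (subsetP sB).
have BQ : i |: B \notin Q.
  apply/negP => /(partitionS pQ) /subsetP /(_ i); rewrite setU11 => /(_ isT).
  by rewrite inE (negbTE iU) andbF.
have nB := nuS_ge_card B.
rewrite !big_setU1 //= -/k cardsU1 BQ.
(* By [sum_dindex], the exponent of x_1 and the index of the new variable depend on B and Q but not
   on P, so the monomial factors out of the sum over P. *)
transitivity (\sum_(P | partition P B) ((\prod_(J in P) bcoef_set J) *
     (opX_coef 0 k.+1 (\sum_(J in P) dindex_set J) #|P| / \prod_(J in P) (dindex_set J)`!%:R)) *: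
   (\prod_(J in Q) bcoef_set J *: (dp (e - (1 + #|Q|)%N%:Z - (k + nuS U)%N%:Z) *
     (var A (dindex_set (i |: B)) * \prod_(J in Q) var A (dindex_set J))))).
  apply: eq_bigr => P pP; rewrite /F /opX_coef; case: leqP => Pk; last first.
    by rewrite mul0r !mulr0 !scale0r.
  have sP := sum_dindex pP.
  rewrite scalerA [_ * (_ / _) * _]mulrAC; congr (_ *: _); rewrite mulrA; congr (_ * _).
  rewrite mulrC; congr (_ * _); first by congr divpow; lia.
  congr var; rewrite [dindex_set (i |: B)]/dindex_set big_setU1 //= cardsU1 iB -/k [(true + _)%N]add1n subSS add0n.
  move: sP Pk nB; move: (\sum_(J in P) _)%N (nuS B) #|P| #|B| => x y p b. lia.
rewrite -scaler_suml sum_partition_bcoef scalerA; congr (_ *: _); congr (_ * _).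
by rewrite /bcoef_set !big_setU1.
Qed.

End FourierFormula.

(** * Unfolding the recursive operators into sums over tuples *)

Lemma sum_tuple_cons (V : nmodType) (T : finType) k (F : k.+1.-tuple T -> V) :
  \sum_t F t = \sum_(i : T) \sum_(t : k.-tuple T) F [tuple of i :: t].
Proof.
rewrite pair_big /= (reindex (fun p : T * k.-tuple T => [tuple of p.1 :: p.2])) //=.
exists (fun t => (thead t, [tuple of behead t])) => [[i t] _|t _] /=.
  by congr pair; apply: val_inj.
by rewrite -tuple_eta.
Qed.

Section TupleSum.
Context {A : derivAlg}.

Lemma foldr_der i (s : seq nat) (f : A) : (0 < i)%N -> all (leq 1) s ->
  foldr (fun j => der A j) (der A i f) s = der A i (foldr (fun j => der A j) f s).
Proof. by move=> i0; elim: s => //= j s IHs /andP[j0 /IHs ->]; rewrite derC. Qed.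

(** The successive binomials multiply to a multinomial coefficient; at n = 0 this identifies the
    recursive operator with D_k. *)
Lemma opX_upto_tuple N n k (f : A) :
  opX_upto N n k f = k`!%:R^-1 *: \sum_(t : k.-tuple 'I_N)
    ((n + sumn [seq (val i).+1 | i <- t])`!%:R
       / (n`!%:R * \prod_(j <- [seq (val i).+1 | i <- t]) j`!%:R))
    *: (var A (n + sumn [seq (val i).+1 | i <- t]).-1
        * foldr (fun j => der A j) f [seq (val i).+1 | i <- t]).
Proof.
elim: k n f => [|k IHk] n f.
  rewrite opX_upto0 invr1 scale1r (big_pred1 [tuple]) => [|t]; last exact/esym/eqP/tuple0.
  by rewrite /= big_nil addn0 mulr1 divff ?fact_neq0 // scale1r.
rewrite opX_uptoS sum_tuple_cons factS_rat invfM -scalerA; congr (_ *: _).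
rewrite scaler_sumr; apply: eq_bigr => i _; rewrite IHk scalerA [_ * _^-1]mulrC -scalerA.
congr (_ *: _); rewrite scaler_sumr; apply: eq_bigr => t _.
rewrite scalerA [[seq _ | _ <- [tuple of _]]]/= big_cons [sumn (_ :: _)]/= addnA.
rewrite [foldr _ _ (_ :: _)]/= -foldr_der //; last by apply/allP => j /mapP[l _ ->].
congr (_ *: _); set p := \prod_(j <- _) _.
have p0 : p != 0 by rewrite prodf_seq_neq0; apply/allP => j _; apply: fact_neq0.
by rewrite binE_rat; field; rewrite !fact_neq0 p0.
Qed.

End TupleSum.

(** * Change of index set in the formula for S *)

Section Transport.
Context (I J : finType) (h : J -> I) (h_inj : injective h).

Lemma sum_partition_imset (V : nmodType) (F : {set {set I}} -> V) (U : {set J}) :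
  \sum_(Q | partition Q (h @: U)) F Q
    = \sum_(Q | partition Q U) F [set h @: B | B : {set J} in Q].
Proof.
have hh : injective (fun B : {set J} => h @: B) by apply: imset_inj.
rewrite (reindex_onto (fun Q : {set {set J}} => [set h @: B | B : {set J} in Q])
  (fun Q => [set h @^-1: B | B : {set I} in Q])) /=; last first.
  move=> Q pQ; rewrite -imset_comp -[RHS]imset_id; apply: eq_in_imset => B BQ /=.
  apply/setP => i; apply/imsetP/idP => [[j + ->]|iB]; first by rewrite inE.
  have /imsetP[j _ ej] := subsetP (partitionS pQ BQ) _ iB.
  by exists j; rewrite // inE -ej.
apply: eq_bigl => Q; rewrite imset_partition // andb_idr // => _; apply/eqP.
rewrite -imset_comp -[RHS]imset_id; apply: eq_in_imset => B _ /=.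
by apply/setP => j; rewrite inE mem_imset.
Qed.

Lemma Sform_imset {A : derivAlg} (nu : I -> nat) (mu : J -> nat) e (U : {set J}) :
  (forall j, nu (h j) = mu j) -> Sform nu e (h @: U) = Sform mu e U :> A.
Proof.
move=> nuh; have hh : injective (fun B : {set J} => h @: B) by apply: imset_inj.
have sumh (B : {set J}) : (\sum_(i in h @: B) nu i = \sum_(j in B) mu j)%N.
  by rewrite big_imset /= => [|i j _ _]; [apply: eq_bigr => j _ | apply: h_inj].
rewrite /Sform sum_partition_imset; apply: eq_bigr => Q pQ.
rewrite card_imset // sumh !big_imset /=; try by move=> B C _ _; apply: hh.
congr (_ *: (_ * _)).
  apply: eq_bigr => B _; rewrite /bcoef_set sumh big_imset /= => [|i j _ _]; last exact: h_inj.
  by congr (_ / _); apply: eq_bigr => j _; rewrite nuh.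
by apply: eq_bigr => B _; rewrite /dindex_set sumh card_imset.
Qed.

End Transport.

(** * The ring Q[x_1, x_2, ...] *)

Lemma cmonom_ind (P : {cmonom nat} -> Prop) :
    P mone -> (forall i m, P m -> P (mmul (ucm i) m)) -> forall m, P m.
Proof.
move=> P1 PM m; have [n] := ubnP (mdeg m); elim: n m => // n IHn m le_m.
have [-> //|] := eqVneq m mone; rewrite -mdeg_eq0 mdegE => m_neq1.
have [i im] : exists i, i \in finsupp m.
  case: (finsupp m =P fset0) => [m0|/eqP/fset0Pn //].
  by rewrite m0 big_nil in m_neq1.
have em : m = mmul (ucm i) (divcm m (ucm i)).
  apply/eqP/cmP => j; rewrite cmM divcmE cmU.
  case: eqP => [<-|_]; last by rewrite subn0.
  by rewrite subnKC // lt0n cmE_neq0.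
rewrite em; apply/PM/IHn; move: le_m; rewrite {1}em mdegM mdegU; lia.
Qed.

Lemma monalgUZ (c : rat) (m : {cmonom nat}) : << c *g m >> = c *: (<< m >> : QX).
Proof. by apply/malgP => i; rewrite mcoeffU mcoeffZ mcoeffU mulr_natr. Qed.

Lemma xvarU j (m : {cmonom nat}) : xvar j * << m >> = << mmul (ucm j.-1) m >> :> QX.
Proof. by rewrite /xvar malgM_def fgmulUU mulr1. Qed.

Lemma QX_ind (P : QX -> Prop) :
    P 1 -> (forall c f h, P f -> P h -> P (c *: f + h)) ->
    (forall j f, (0 < j)%N -> P f -> P (xvar j * f)) -> forall f, P f.
Proof.
move=> P1 PD PX.
have PU (m : {cmonom nat}) : P << m >>.
  elim/cmonom_ind: m => [|i m Pm]; first exact: P1.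
  rewrite -[i]/(i.+1.-1) -xvarU; exact: (PX i.+1 _ (ltn0Sn i) Pm).
move=> f; rewrite (monalgE f); elim/big_rec: _ => [|m h _ Ph].
  rewrite -[0](addNr 1) -scaleN1r; exact: (PD (-1) 1 1 P1 P1).
rewrite monalgUZ; exact: (PD _ _ _ (PU m) Ph).
Qed.

Lemma pd_is_linear n : linear (pd n).
Proof.
move=> c f h; apply/malgP => m.
apply: (etrans (mcoeff_pd n _ m)); set u := mmul m _; set k := _%:R.
have e1 : (c *: f + h)@_u = c * f@_u + h@_u.
  exact: (etrans (mcoeffD u (c *: f) h) (congr1 (fun x => x + h@_u) (mcoeffZ c f u))).
have e2 : (c *: pd n f + pd n h)@_m = c * (f@_u * k) + h@_u * k.
  apply: (etrans (mcoeffD m (c *: pd n f) (pd n h))).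
  apply: (congr2 +%R _ (mcoeff_pd n h m)).
  exact: (etrans (mcoeffZ c (pd n f) m) (congr1 (fun x => c * x) (mcoeff_pd n f m))).
apply: (etrans (congr1 (fun x => x * k) e1)); apply: (etrans _ (esym e2)).
by clear e1 e2; move: (f@_u) (h@_u) k => a b k; ring.
Qed.

HB.instance Definition _ n := GRing.isLinear.Build rat QX QX _ (pd n) (pd_is_linear n).

Lemma pd_one n : pd n 1 = 0.
Proof.
apply: pd_free => m; rewrite -mcoeff_neq0 mcoeff1.
by have [->|_] := eqVneq m mone; rewrite ?cm1 ?eqxx.
Qed.

Lemma mcoeff_xvarM j (f : QX) m :
  (xvar j * f)@_m = f@_(divcm m (ucm j.-1)) *+ (0 < m j.-1)%N.
Proof.
rewrite {1}(monalgE f) mulr_sumr raddf_sum /= [in RHS](monalgE f) raddf_sum /= -sumrMnl.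
apply: eq_bigr => k _.
have -> : xvar j * << f@_k *g k >> = << f@_k *g mmul (ucm j.-1) k >> :> QX.
  by rewrite /xvar malgM_def fgmulUU mul1r.
rewrite !mcoeffU -mulrnA mulnb; congr (_ *+ nat_of_bool _).
apply/eqP/andP => [<-|[/eqP -> m0]]; last first.
  by apply/eqP/cmP => i; rewrite cmM divcmE cmU; case: eqP => [<-|_]; rewrite ?add0n ?subn0 ?subnKC.
by rewrite cmM cmUU; split => //; apply/cmP => i; rewrite divcmE cmM addKn.
Qed.

Lemma pd_xvar n j (f : QX) : (0 < n)%N -> (0 < j)%N ->
  pd n (xvar j * f) = xvar j * pd n f + (n == j)%:R *: f.
Proof.
move=> n0 j0; apply/malgP => m.
apply: (etrans (mcoeff_pd _ _ _)); apply: (etrans _ (esym (mcoeffD m _ _))).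
apply: (etrans _ (esym (congr2 +%R (mcoeff_xvarM _ _ _) (mcoeffZ _ _ _)))).
apply: (etrans (congr1 (fun x => x * _) (mcoeff_xvarM _ _ _))).
apply: (etrans _ (esym (congr1 (fun x => x *+ _ + _) (mcoeff_pd _ _ _)))).
rewrite cmM cmU.
have -> : (n == j) = (n.-1 == j.-1) by lia.
have [->|nj] := eqVneq n.-1 j.-1.
  rewrite addn1 mulr1n mul1r.
  have -> : divcm (mmul m (ucm j.-1)) (ucm j.-1) = m.
    by apply/eqP/cmP => i; rewrite divcmE cmM addnK.
  case: (posnP (m j.-1)) => [->|m0]; first by rewrite mulr0n add0r mulr1.
  have -> : mmul (divcm m (ucm j.-1)) (ucm j.-1) = m.
    by apply/eqP/cmP => i; rewrite cmM divcmE cmU; case: eqP => [<-|_]; rewrite ?addn0 ?subn0 ?subnK.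
  by rewrite mulr1n divcmE cmUU subn1 prednK // -natr1 mulrDr mulr1.
rewrite addn0 mul0r addr0 divcmE cmU eq_sym (negbTE nj) subn0 mulrnAl.
have -> : divcm (mmul m (ucm n.-1)) (ucm j.-1) = mmul (divcm m (ucm j.-1)) (ucm n.-1) :> {cmonom nat}.
  apply/eqP/cmP => i; rewrite cmM !divcmE cmM !cmU; case: eqP; case: eqP; lia.
by [].
Qed.

Lemma pd_nvars n (f : QX) : (nvars f < n)%N -> pd n f = 0.
Proof. by move=> nf; apply/pd_free/free_of_nvars. Qed.

Definition QXd : derivAlg := @DerivAlg QX xvar (fun n => pd n) nvars pd_one pd_xvar pd_nvars QX_ind.

Lemma DopE k (f : QX) : Dop k f = @opX QXd 0 k f.
Proof.
have vf : @vbounded QXd (nvars f) f by move=> n; apply: pd_nvars.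
apply: (etrans _ (esym (@opXE QXd (nvars f) 0 k f vf))).
apply: (etrans _ (esym (@opX_upto_tuple QXd (nvars f) 0 k f))).
apply: (congr1 (fun h => k`!%:R^-1 *: h)).
apply: eq_bigr => t _; apply: (congr1 (fun c : rat => c *: _)).
by rewrite (_ : 0`!%:R = 1 :> rat) // mul1r add0n.
Qed.

Lemma DgE g (f : QX) : Dg g f = @opD QXd g f.
Proof. by rewrite /Dg DopE. Qed.

Lemma Dop_Dg k g (f : QX) : (3 <= k)%N -> Dop k (Dg g f) = Dg g (Dop k f).
Proof. by move=> k3; rewrite !DopE !DgE; apply: (@opX_opD QXd). Qed.

Lemma wdegEw (m : {cmonom nat}) (d : {fset nat}) : (finsupp m `<=` d)%fset ->
  wdeg m = (\sum_(i <- d) m i * i.+1)%N.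
Proof.
move=> sd; rewrite /wdeg; apply: big_fset_incl => // i _ im.
by move: im; rewrite -cmE_eq0 => /eqP ->.
Qed.

Lemma wdegM (m1 m2 : {cmonom nat}) : wdeg (mmul m1 m2) = (wdeg m1 + wdeg m2)%N.
Proof.
pose d := (finsupp m1 `|` finsupp m2)%fset.
rewrite (@wdegEw _ d) ?mdomD // (@wdegEw m1 d) ?fsubsetUl // (@wdegEw m2 d) ?fsubsetUr //.
by rewrite -big_split /=; apply: eq_bigr => i _; rewrite cmM mulnDl.
Qed.

Lemma wdegU i : wdeg (ucm i) = i.+1.
Proof. by rewrite /wdeg mdomU big_seq_fset1 cmUU mul1n. Qed.

Lemma wdeg1 : wdeg mone = 0%N.
Proof. by rewrite /wdeg mdom1 big_seq_fset0. Qed.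

Lemma divpow0 (R : comAlgType rat) (x : R) : divpow x 0 = 1.
Proof. by rewrite /= scale1r. Qed.

Lemma mul_scale_divpow (R : comAlgType rat) (x f : R) (c : rat) (a : nat) :
  x * (c *: (divpow x a * f)) = (c * a.+1%:R) *: (divpow x a.+1 * f).
Proof.
rewrite -scalerAr mulrA divpow_S (_ : Posz a + 1 = Posz a.+1); last by lia.
by rewrite -scalerAl scalerA.
Qed.

Lemma divpow_succ (R : comAlgType rat) (x f : R) (a : nat) :
  divpow x a.+1 * f = a.+1%:R^-1 *: (x * (divpow x a * f)).
Proof.
rewrite -[divpow x a * f]scale1r mul_scale_divpow mul1r scalerA mulVf ?scale1r //.
by rewrite pnatr_eq0.
Qed.

Lemma scale_mul_scale (R : comAlgType rat) (x f : R) (b c : rat) :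
  b *: (x * (c *: f)) = (c * b) *: (x * f).
Proof. by rewrite -scalerAr scalerA mulrC. Qed.

Lemma mul_scale_mulCA (R : comAlgType rat) (x y f : R) (c : rat) :
  x * (c *: (y * f)) = c *: (y * (x * f)).
Proof. by rewrite -scalerAr mulrCA. Qed.

Local Notation dp := (divpow (xvar 1)).

Lemma monomial_prod (m : {cmonom nat}) : exists (r : nat) (nu : 'I_r -> nat) (c : rat),
  [/\ forall i, (1 < nu i)%N, wdeg m = (m 0 + \sum_(i < r) nu i)%N
    & << m >> = c *: (dp (m 0) * \prod_(i < r) xvar (nu i)) :> QX].
Proof.
elim/cmonom_ind: m => [|[|j] m [r [nu [c [nu1 wm em]]]]].
- exists 0%N, (fun i => 0%N), 1; split; first by case.
    by rewrite big_ord0 wdeg1 cm1.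
  by rewrite cm1 big_ord0 mulr1 /= !scale1r.
- exists r, nu, (c * (m 0).+1%:R); split; first exact: nu1.
    by rewrite wdegM wdegU wm cmM cmUU addnA.
  have e0 : mmul (ucm 0) m 0 = (m 0).+1 by rewrite cmM cmUU.
  rewrite e0; apply: (etrans (esym (xvarU 1 m))).
  apply: (etrans (congr1 (fun f => xvar 1 * f) em)); exact: mul_scale_divpow.
exists r.+1, (fun i => if unlift ord0 i is Some i' then nu i' else j.+2), c; split.
- by move=> i; case: unliftP => [i' _|_] //.
- rewrite big_ord_recl unlift_none wdegM wdegU wm cmM cmU add0n addnCA; congr (_ + (_ + _))%N.
  by apply: eq_bigr => i _; rewrite liftK.
have e0 : mmul (ucm j.+1) m 0 = m 0 by rewrite cmM cmU.
rewrite e0; apply: (etrans (esym (xvarU j.+2 m))).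
apply: (etrans (congr1 (fun f => xvar j.+2 * f) em)).
apply: (etrans (mul_scale_mulCA _ _ _ _)); apply: (congr1 (fun f => c *: (dp (m 0) * f))).
rewrite big_ord_recl unlift_none; apply: (congr1 (fun f => xvar j.+2 * f)).
by apply: eq_bigr => i _; rewrite liftK.
Qed.

Lemma prod_monomial (I : finType) (U : {set I}) (nu : I -> nat) (a : nat) :
    (forall i, i \in U -> (1 < nu i)%N) ->
  exists (m : {cmonom nat}) (c : rat), [/\ m 0 = a, wdeg m = (a + \sum_(i in U) nu i)%N
    & dp a * \prod_(i in U) xvar (nu i) = c *: (<< m >> : QX)].
Proof.
move=> nuU.
have [m [m0 wm em]] : exists m : {cmonom nat}, [/\ m 0 = 0%N, wdeg m = (\sum_(i in U) nu i)%N
    & \prod_(i in U) xvar (nu i) = << m >> :> QX].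
  elim/finset_ind: U nuU => [|U i iU IHU] nuU.
    by exists mone; rewrite !big_set0; split; [exact: cm1 | exact: wdeg1 | ].
  have [|m [m0 wm em]] := IHU; first by move=> j jU; apply/nuU/setU1r.
  have nui := nuU i (setU11 i U); exists (mmul (ucm (nu i).-1) m).
  split.
  - by rewrite cmM cmU m0 addn0; case: (nu i) nui => [|[|]].
  - by rewrite wdegM wdegU wm big_setU1 //= prednK ?(ltnW nui).
  rewrite big_setU1; last exact: iU.
  exact: (etrans (congr1 (fun f => xvar (nu i) * f) em) (xvarU (nu i) m)).
elim: a => [|a [m' [c [m'0 wm' em']]]].
  exists m, 1; split; [exact: m0 | exact: wm |].
  apply: (etrans (congr1 (fun f => dp 0 * f) em)).
  apply: (etrans (congr1 (fun f => f * _) (divpow0 _))).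
  exact: (etrans (mul1r _) (esym (scale1r _))).
exists (mmul (ucm 0) m'), (c / a.+1%:R); split.
- by rewrite cmM cmUU m'0.
- by rewrite wdegM wdegU wm' addnA.
apply: (etrans (divpow_succ _ _ _)).
apply: (etrans (congr1 (fun f => a.+1%:R^-1 *: (xvar 1 * f)) em')).
apply: (etrans (scale_mul_scale _ _ _ _)).
exact: (congr1 (fun f => (c / a.+1%:R) *: f) (xvarU 1 m')).
Qed.

Lemma spanned_sub (V : lmodType rat) (G H : V -> Prop) f :
  (forall f, G f -> spanned H f) -> spanned G f -> spanned H f.
Proof.
move=> GH; elim=> [|c f' h' Gf' _ IH]; first exact: spanned0.
by apply: spannedD => //; apply/spannedZ/GH.
Qed.

Lemma lin_spanP (G : QX -> Prop) f : lin_span G f <-> spanned G f.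
Proof.
split=> [[s [Gs ->]]|].
  rewrite big_seq; apply: spanned_sum => cp cps; apply: spannedZ; apply: spanned_gen.
  exact: Gs.
elim=> [|c f' h Gf' _ [s [Gs eh]]].
  by exists [::]; split; [move=> cp; rewrite in_nil | rewrite big_nil].
exists ((c, f') :: s); split.
  by move=> cp; rewrite inE => /orP[/eqP ->|]; [exact: Gf' | exact: Gs].
rewrite big_cons; exact: (congr1 (fun x => c *: f' + x) eh).
Qed.

Lemma lowmon_monomial g (f : QX) : @lowmon QXd g f ->
  exists (m : {cmonom nat}) (c : rat), [/\ wdeg m = g, (m 0 < g)%N & f = c *: (<< m >> : QX)].
Proof.
move=> [I [U [nu [a [U0 nuU eg ->]]]]].
have [m [c [m0 wm em]]] := prod_monomial a nuU.
exists m, c; split; [by rewrite wm | | exact: em].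
have /set0Pn[i iU] := U0; rewrite m0 -eg -addn1 leq_add2l.
by rewrite (bigD1 i) //= (leq_trans _ (leq_addr _ _)) // ltnW // nuU.
Qed.

Lemma monomial_lowmon g (m : {cmonom nat}) : wdeg m = g -> (m 0 < g)%N ->
  exists (c : rat) (h : QX), @lowmon QXd g h /\ << m >> = c *: h.
Proof.
move=> wm m0; have [r [nu [c [nu1 wm' em]]]] := monomial_prod m.
exists c, (divpow (xvar 1) (m 0) * \prod_(i < r) xvar (nu i)); split; last exact: em.
exists 'I_r, [set: 'I_r], nu, (m 0); split.
- apply/negP => /eqP/setP e; move: m0; rewrite -wm wm' big1 ?addn0 ?ltnn // => i _.
  by have := e i; rewrite !inE.
- by move=> i _.
- by rewrite -wm wm'; congr (_ + _)%N; apply: eq_bigl => i; rewrite inE.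
by apply: (congr1 (fun h => divpow (xvar 1) (m 0) * h)); apply: eq_bigl => i; rewrite inE.
Qed.

Lemma Dop_monomial_spanned k (m : {cmonom nat}) : (3 <= k)%N ->
  spanned (@lowmon QXd (wdeg m).-1) (Dop k << m >>).
Proof.
move=> k3; have [r [nu [c [nu1 wm em]]]] := monomial_prod m.
have nuT i : i \in [set: 'I_r] -> (1 < nu i)%N by [].
have := spannedZ c (@opX_mon_spanned QXd k _ nu [set: 'I_r] (m 0) k3 nuT).
have -> : (m 0 + \sum_(i in [set: 'I_r]) nu i = wdeg m)%N.
  by rewrite wm; congr (_ + _)%N; apply: eq_bigl => i; rewrite inE.
suff -> : Dop k << m >> = c *: @opX QXd 0 k
  (divpow (xvar 1) (m 0) * \prod_(i in [set: 'I_r]) xvar (nu i)) by apply.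
apply: (etrans (DopE k _)).
apply: (etrans (congr1 (@opX QXd 0 k) em)); apply: (etrans (@opXZ QXd _ _ _ _)).
apply: (congr1 (fun h => c *: @opX QXd 0 k (divpow (xvar 1) (m 0) * h))).
by apply: eq_bigl => i; rewrite inE.
Qed.

Lemma lowmon_jac_gen g d (f : QX) : (g <= d)%N -> @lowmon QXd d f -> spanned (jac_gen g) f.
Proof.
move=> gd /lowmon_monomial[m [c [wm m0 ->]]]; apply: spannedZ; apply: spanned_gen.
case: (ltngtP g d) gd => // [gd|eg] _.
  left; exists d => // m'; rewrite msuppU1 in_fset1 => /eqP ->; exact: wm.
by right; exists 0%N, m; split; [rewrite eg | rewrite eg |].
Qed.

Lemma Dop_is_linear k : linear (Dop k : QX -> QX).
Proof.
move=> c f h; apply: (etrans (DopE k _)); apply: (etrans (@opX_is_linear QXd 0 k c f h)).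
exact: (congr2 (fun x y => c *: x + y) (esym (DopE k f)) (esym (DopE k h))).
Qed.

HB.instance Definition _ k := GRing.isLinear.Build rat QX QX _ (Dop k : QX -> QX) (Dop_is_linear k).

Lemma Dg_is_linear g : linear (Dg g).
Proof.
move=> c f h; apply: (etrans (DgE g _)); apply: (etrans (@opD_is_linear QXd g c f h)).
exact: (congr2 (fun x y => c *: x + y) (esym (DgE g f)) (esym (DgE g h))).
Qed.

Lemma iter_is_linear (V : lmodType rat) (F : V -> V) d : linear F -> linear (iter d F).
Proof.
move=> linF; elim: d => [|d IHd] c f h; first by [].
by rewrite !iterS (IHd c f h) linF.
Qed.

Lemma iter_Dg_spanned g d (w : QX) : spanned (@lowmon QXd g) w ->
  spanned (jac_gen g) (iter d (Dg g) w).
Proof.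
pose iterD : QX -> QX := iter d (Dg g).
have iter_lin : linear iterD := iter_is_linear d (Dg_is_linear g).
pose iterM := GRing.isLinear.Build rat QX QX _ iterD iter_lin.
pose iterL : {linear QX -> QX} := HB.pack iterD iterM.
apply: (@spanned_map _ _ iterL) => f /lowmon_monomial[m [c [wm m0 ->]]].
rewrite linearZ; apply: spannedZ; apply: spanned_gen.
by right; exists d, m.
Qed.

(** Checked on the two kinds of generators: degree > g by [Dop_monomial_spanned], and D^d of a
    monomial by commutation and [opX_lowmon]. *)
Lemma Dop_jacI g k (f : QX) : (3 <= k)%N -> jacI g f -> jacI g (Dop k f).
Proof.
move=> k3 /lin_spanP jf; apply/lin_spanP.
move: jf; apply: (@spanned_map _ _ (Dop k)) => {}f.
rewrite -[X in _ -> spanned _ X]/(Dop k f) => -[[d gd hf]|[d [m [wm m0 ->]]]].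
  rewrite (monalgE f) linear_sum big_seq; apply: spanned_sum => m fm.
  rewrite monalgUZ linearZ; apply: spannedZ.
  apply: spanned_sub (Dop_monomial_spanned m k3) => h.
  by apply: lowmon_jac_gen; rewrite (hf _ fm); lia.
have -> : Dop k (iter d (Dg g) << m >>) = iter d (Dg g) (Dop k << m >>).
  elim: d => [|d IHd]; first exact: erefl.
  exact: (etrans (Dop_Dg g _ k3) (congr1 (Dg g) IHd)).
have [c [h [lh eh]]] := monomial_lowmon wm m0.
have [w lw ew] := opX_lowmon k3 lh.
have -> : Dop k << m >> = Dg g (c *: w).
  apply: (etrans (DopE k _)); apply: (etrans (congr1 (@opX QXd 0 k) eh)).
  apply: (etrans (@opXZ QXd _ _ _ _)); apply: (etrans (congr1 (fun x => c *: x) ew)).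
  apply: esym; apply: (etrans (DgE g _)); exact: (@opDZ QXd).
(* Since D_k(m) = D(c w), applying D^d gives D^(d+1)(c w) with c w in the span of admissible
   monomials of degree g. *)
rewrite -iterSr; exact: iter_Dg_spanned (spannedZ c lw).
Qed.

(** * The operators on the quotient ring *)

Lemma linear_sign (R : comAlgType rat) (F : {linear R -> R}) n (x : R) :
  F ((-1) ^+ n * x) = (-1) ^+ n * F x.
Proof. by rewrite -signr_odd !mulr_sign; case: (odd n); rewrite ?linearN. Qed.

Section Quotient.
Context (g : nat) (R : comAlgType rat) (pi : {lrmorphism QX -> R}) (hR : is_RJac g pi).

Lemma pi_surj (F : R) : exists f : QX, pi f == F.
Proof. by have [f <-] := hR.1 F; exists f. Qed.

Definition lift_pi (F : R) : QX := xchoose (pi_surj F).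

Lemma lift_piK F : pi (lift_pi F) = F.
Proof. exact/eqP/(xchooseP (pi_surj F)). Qed.

Lemma pi_Dop k (f h : QX) : (3 <= k)%N -> pi f = pi h -> pi (Dop k f) = pi (Dop k h).
Proof.
move=> k3 efh; have piB (u v : QX) : pi (u - v) = pi u - pi v by apply: raddfB.
have j_fh : jacI g (f - h) by apply/(hR.2 _).1; rewrite piB efh subrr.
have := (hR.2 _).2 (Dop_jacI k3 j_fh).
rewrite (_ : Dop k (f - h) = Dop k f - Dop k h); last exact: raddfB.
by rewrite piB => /eqP; rewrite subr_eq0 => /eqP.
Qed.

(** Descent is established for k >= 3 only; the default value 0 makes [Dbar k] linear for every
    k. *)
Definition Dbar k (F : R) : R := if (3 <= k)%N then pi (Dop k (lift_pi F)) else 0.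

Lemma Dbar_pi k (f : QX) : (3 <= k)%N -> Dbar k (pi f) = pi (Dop k f).
Proof.
by move=> k3; rewrite /Dbar k3; exact: pi_Dop k3 (lift_piK (pi f)).
Qed.

Lemma Dbar_is_linear k : linear (Dbar k).
Proof.
move=> c F G; rewrite /Dbar; case k3: (3 <= k)%N; last by rewrite scaler0 addr0.
have piP (u v : QX) : pi (c *: u + v) = c *: pi u + pi v by apply: linearP.
have e1 : pi (c *: lift_pi F + lift_pi G) = c *: F + G by rewrite piP !lift_piK.
rewrite -piP; apply: (etrans (pi_Dop k3 (etrans (lift_piK (c *: F + G)) (esym e1)))).
by apply: (congr1 pi); exact (Dop_is_linear k c (lift_pi F) (lift_pi G)).
Qed.

HB.instance Definition _ k := GRing.isLinear.Build rat R R _ (Dbar k) (Dbar_is_linear k).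

Lemma rmorph_divpow (x : QX) (z : int) : pi (divpow x z) = divpow (pi x) z.
Proof.
case: z => [n|n]; last exact: rmorph0.
exact: (etrans (linearZ _ _) (congr1 (fun h => n`!%:R^-1 *: h) (rmorphXn pi n x))).
Qed.

Lemma multinom_bcoef (k : nat) (ns : 'I_k -> nat) (J : {set 'I_k}) : bcoef ns J = bcoef_set ns J.
Proof.
rewrite /bcoef /multinom /bcoef_set big_map big_enum /=; congr (_`!%:R / _).
by rewrite sumnE big_map big_enum.
Qed.

Lemma pi_Sform (k n : nat) (ns : 'I_k -> nat) :
  pi (@Sform QXd _ ns (g%:Z - n%:Z) [set: 'I_k]) = Sformula (fun n => pi (xvar n)) g ns n.
Proof.
apply: (etrans (raddf_sum pi _ _ _)); apply: eq_bigr => Q pQ.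
apply: (etrans (linearZ _ _)).
have -> : \prod_(J in Q) bcoef_set ns J = \prod_(I in Q) bcoef ns I.
  by apply: eq_bigr => J _; rewrite multinom_bcoef.
apply: (congr1 (fun h => _ *: h)); apply: (etrans (rmorphM pi _ _)).
apply: (congr2 *%R).
  apply: (etrans (rmorph_divpow _ _)); congr divpow; congr (_ - _); congr Posz.
  by apply: eq_bigl => i; rewrite inE.
exact: (rmorph_prod pi).
Qed.

Section Fourier.
Context (S : {linear R -> R}) (hS : is_S g pi S).
Local Notation p n := (pi (xvar n)).

Lemma signK n (F : R) : (-1) ^+ n * ((-1) ^+ n * F) = F.
Proof. by rewrite mulrA -expr2 sqrr_sign mul1r. Qed.

Lemma S_monomial (r n : nat) (ns : 'I_r -> nat) : (forall i, 1 < ns i)%N ->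
  S (divpow (p 1%N) n * \prod_(i < r) p (ns i))
    = (-1) ^+ n * pi (@Sform QXd _ ns (g%:Z - n%:Z) [set: 'I_r]).
Proof. by move=> ns1; rewrite pi_Sform -(hS n ns1) signK. Qed.

(** Multiplication by p_k adds k to the list of indices and leaves n unchanged, so the claim is the
    image under [pi] of [opX_Sform], with the old indices embedded by [lift ord0]. *)
Lemma S_mul_monomial (r n k : nat) (ns : 'I_r -> nat) :
    (forall i, 1 < ns i)%N -> (2 <= k)%N ->
  S (p k * (divpow (p 1%N) n * \prod_(i < r) p (ns i)))
    = Dbar k.+1 (S (divpow (p 1%N) n * \prod_(i < r) p (ns i))).
Proof.
move=> ns1 k2; pose ns' (i : 'I_r.+1) := if unlift ord0 i is Some j then ns j else k.
have ns'1 i : (1 < ns' i)%N by rewrite /ns'; case: unliftP.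
have nsl j : ns' (lift ord0 j) = ns j by rewrite /ns' liftK.
have ns0 : ns' ord0 = k by rewrite /ns' unlift_none.
have prod' : \prod_(i < r.+1) p (ns' i) = p k * \prod_(i < r) p (ns i).
  rewrite big_ord_recl.
  apply: (congr2 *%R (congr1 (fun j => p j) ns0)).
  apply: eq_bigr => j _; exact: (congr1 (fun j => p j) (nsl j)).
have eL : S (p k * (divpow (p 1%N) n * \prod_(i < r) p (ns i))) =
    (-1) ^+ n * pi (@Sform QXd _ ns' (g%:Z - n%:Z) [set: 'I_r.+1]).
  apply: (etrans (congr1 S (mulrCA _ _ _))).
  apply: (etrans (congr1 (fun h => S (_ * h)) (esym prod'))); exact: S_monomial.
apply: (etrans eL); apply: (etrans _ (congr1 (Dbar k.+1) (esym (S_monomial n ns1)))).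
apply: (etrans _ (esym (linear_sign (Dbar k.+1) _ _))); apply: (congr1 (fun h => (-1) ^+ n * h)).
have e1 := @Dbar_pi k.+1 (@Sform QXd _ ns (g%:Z - n%:Z) [set: 'I_r]) k2.
apply: (etrans _ (esym e1)); apply: (congr1 pi); apply: esym; apply: (etrans (DopE _ _)).
have -> : @Sform QXd _ ns (g%:Z - n%:Z) [set: 'I_r]
    = @Sform QXd _ ns' (g%:Z - n%:Z) [set lift ord0 j | j in [set: 'I_r]].
  by apply: esym; exact: (Sform_imset (@lift_inj _ ord0) _ _ nsl).
rewrite -{1}ns0.
have i0 : ord0 \notin [set lift ord0 j | j in [set: 'I_r]].
  by apply/imsetP => -[j _ /eqP]; rewrite (negbTE (neq_lift _ _)).
apply: (etrans (@opX_Sform QXd _ ns' (fun i => ltnW (ns'1 i)) _ _ _ i0)).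
apply: (congr1 (@Sform QXd _ ns' (g%:Z - n%:Z))).
apply/setP => i; rewrite !inE; case: (unliftP ord0 i) => [j ->|-> //].
by rewrite imset_f ?orbT.
Qed.

Lemma S_mul_xvar k (f : QX) : (2 <= k)%N -> S (p k * pi f) = Dbar k.+1 (S (pi f)).
Proof.
move=> k2; pose P (h : QX) := S (p k * pi h) = Dbar k.+1 (S (pi h)).
have PD c (h1 h2 : QX) : P h1 -> P h2 -> P (c *: h1 + h2).
  rewrite /P => e1 e2; have -> : pi (c *: h1 + h2) = c *: pi h1 + pi h2 by apply: linearP.
  by rewrite mulrDr -scalerAr !linearP e1 e2.
have P0 : P 0.
  by rewrite /P (_ : pi 0 = 0) ?mulr0 ?linear0 //; apply: rmorph0.
have PU (m : {cmonom nat}) : P << m >>.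
  have [r [nu [c [nu1 _ em]]]] := monomial_prod m.
  have epi : pi << m >> = c *: (divpow (p 1%N) (m 0) * \prod_(i < r) p (nu i)).
    apply: (etrans (congr1 pi em)); apply: (etrans (linearZ _ _)).
    apply: (congr1 (fun h => c *: h)); apply: (etrans (rmorphM pi _ _)).
    exact: (congr2 *%R (rmorph_divpow _ _) (rmorph_prod pi _ _ _)).
  have eZ (G : R) : S (p k * G) = Dbar k.+1 (S G) ->
      S (p k * (c *: G)) = Dbar k.+1 (S (c *: G)).
    by move=> e; rewrite -scalerAr !linearZ e.
  apply: (etrans (congr1 (fun h => S (p k * h)) epi)).
  apply: (etrans (eZ _ (S_mul_monomial (m 0) nu1 k2))).
  exact: (congr1 (fun h => Dbar k.+1 (S h)) (esym epi)).
rewrite (monalgE f) -/(P _); elim/big_rec: _ => [|m h _ Ph]; first exact: P0.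
by rewrite monalgUZ; exact: PD (PU m) Ph.
Qed.

End Fourier.
End Quotient.

Theorem theorem0p6 (g : nat) (hg : (2 <= g)%N) :
  [/\ forall k : nat, (3 <= k)%N ->
        forall f : QX, Dop k (Dg g f) = Dg g (Dop k f),
      forall k : nat, (3 <= k)%N ->
        forall f : QX, jacI g f -> jacI g (Dop k f)
    & forall (R : comAlgType rat) (pi : {lrmorphism QX -> R}),
        is_RJac g pi ->
        exists Dbar : nat -> {linear R -> R},
          (forall k : nat, (3 <= k)%N ->
             forall f : QX, Dbar k (pi f) = pi (Dop k f)) /\
          (forall S Sinv : {linear R -> R},
             is_S g pi S -> cancel S Sinv -> cancel Sinv S ->
             forall k : nat, (2 <= k)%N ->
             forall F : R, S (pi (xvar k) * Sinv F) = Dbar k.+1 F)].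
Proof.
split=> [k k3 f|k k3 f|R pi hR]; [exact: Dop_Dg | exact: Dop_jacI |].
exists (fun k => Dbar hR k); split=> [k k3 f|S Sinv hS SK SinvK k k2 F]; first exact: Dbar_pi.
have [f ef] := hR.1 (Sinv F).
(* Writing F as S(Sinv F) and Sinv F as [pi f] turns the claim into S(p_k pi f) = Dbar (k+1) (S(pi
   f)). *)
rewrite -{2}(SinvK F) -ef; exact: S_mul_xvar.
Qed.
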